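(* For a diagram $D$ of an admissibly colored framed graph write $(D)$ for $\underline{\Delta}(D,c)$, and write $\{k\}_q=q^k-q^{-k}$. The invariant $\underline{\Delta}$ satisfies the following relations. (Labels $i,j,k,l$ denote multiplicities; the fragments $\mathsf{X}$, $\mathsf{H}^{\leftarrow}$, $\mathsf{H}^{\rightarrow}$ and the conventions on omitted data and on multiplicity zero are those of the context. All fragments carry the blackboard framing unless half twists are drawn.) (i) If $D$ is a simple closed planar circle of multiplicity $i$, then $(D)=\dfrac{1}{\{2i\}_q}$. (ii) $(D)=0$ if $D$ is a disconnected diagram. (iii) Removing a positive half twist from an edge colored $(i,I)$: $(D_{\text{with positive half twist}})=q^{-iI}\,(D_{\text{without}})$. For a negative half twist: $(D_{\text{with negative half twist}})=q^{iI}\,(D_{\text{without}})$. (iv) Let $D_1$ contain a bubble: an upward edge of multiplicity $i$ enters a vertex from below; two arcs connect this vertex to a second vertex above it, bounding an empty disk; an upward edge of multiplicity $i$ leaves the second vertex. Let $D_0$ be obtained by replacing this by a single upward edge of multiplicity $i$. Then $(D_1)=\{2i\}_q\,(D_0)$. (v) Consider fragments with four ends: bottom-left (entering, multiplicity $j$), bottom-right (leaving, $i$), top-left (leaving, $j$), top-right (entering, $i$). Let $D_L$ contain the square with vertices $a$ (lower left), $b$ (lower right), $c$ (upper right), $d$ (upper left) and edges $a\to b$ and $c\to d$ of multiplicity $i+j$, $d\to a$ of multiplicity $i$, $b\to c$ of multiplicity $j$, the bottom-left, bottom-right, top-right, top-left ends being attached to $a,b,c,d$ respectively. Let $D_1$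 contain the fragment with a lower vertex $p$, to which the two bottom ends are attached, an upper vertex $r$, to which the two top ends are attached, and one edge $r\to p$ of multiplicity $i-j$. Let $D_2$ contain two disjoint vertical strands: the left one directed upward of multiplicity $j$, the right one directed downward of multiplicity $i$. Then $$(D_L)=\{2i+2j\}_q\,(D_1)+\{2j\}_q^2\,(D_2).$$ (vi) Let $D_L$ contain the tree in which an upward edge of multiplicity $i+j+k$ splits into a left edge of multiplicity $i+j$ and a right edge of multiplicity $k$, and the edge of multiplicity $i+j$ splits into $i$ (left) and $j$ (right); let $D_R$ contain the tree in which the edge $i+j+k$ splits into $i$ (left) and $j+k$ (right), and $j+k$ splits into $j$ (left) and $k$ (right). (In both, the three outgoing ends from left to right are $i,j,k$.) Then $$(D_L)=\frac{\{2i+2j\}_q}{\{2j+2k\}_q}\,(D_R).$$ Let $D'_L$ contain the tree in which upward edges $i,j,k$ (from left to right) merge by first merging $i,j$ into $i+j$ and then $i+j,k$ into $i+j+k$, and $D'_R$ the tree in which first $j,k$ merge into $j+k$ and then $i,j+k$ merge into $i+j+k$. Then $(D'_L)=(D'_R)$. (vii) Let $D_L$ contain two vertical upward strands, the left one having successive multiplicities $i,\ i+k,\ i+k-l$ from bottom to top and the right one $j,\ j-k,\ j+l-k$, joined by a lower edge of multiplicity $k$ directed from the right strand to the left strand and an upper edge of multiplicity $l$ directed from the left strand to the right strand. Then $$(D_L)=\frac{\{2j\}_q\{2l\}_q}{\{2j+2l-2k\}_q}\bigl(\mathsf{X}(i,j;\,i+k-l,\,j+l-k)\bigr)+\frac{\{2i+2k-2l\}_q\{2j-2k\}_q}{\{2j+2l-2k\}_q}\bigl(\mathsf{H}^{\leftarrow}_{k-l}(i,j)\bigr).$$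 (viii) Let $D_+$ (resp. $D_-$) contain a crossing of two upward strands, the strand from bottom left to top right colored $(i,I)$ and the strand from bottom right to top left colored $(j,J)$, where in $D_+$ the strand from bottom left to top right passes over and in $D_-$ the strand from bottom right to top left passes over. In the fragments below the ends are colored $(i,I)$ at bottom left, $(j,J)$ at bottom right, $(j,J)$ at top left, $(i,I)$ at top right. Then $$(D_+)=\frac{q^{i-j-iJ-jI}}{\{2i\}_q}(\mathsf{X}(i,j;j,i))-\frac{q^{-i-j-iJ-jI}}{\{2i\}_q}(\mathsf{H}^{\leftarrow}_{j-i}(i,j))=\frac{q^{j-i-iJ-jI}}{\{2j\}_q}(\mathsf{X}(i,j;j,i))-\frac{q^{-i-j-iJ-jI}}{\{2j\}_q}(\mathsf{H}^{\rightarrow}_{i-j}(i,j)),$$ $$(D_-)=\frac{q^{j-i+iJ+jI}}{\{2i\}_q}(\mathsf{X}(i,j;j,i))-\frac{q^{i+j+iJ+jI}}{\{2i\}_q}(\mathsf{H}^{\leftarrow}_{j-i}(i,j))=\frac{q^{i-j+iJ+jI}}{\{2j\}_q}(\mathsf{X}(i,j;j,i))-\frac{q^{i+j+iJ+jI}}{\{2j\}_q}(\mathsf{H}^{\rightarrow}_{i-j}(i,j)).$$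
   Context: **Graphs and colorings.** A graph $G$ is a finite oriented trivalent graph embedded in $S^3$ without source or sink (loops, multi-edges and vertex-free circle components allowed). A vertex is odd if it has one incoming and two outgoing edges, even if it has two incoming and one outgoing edge. A coloring $c$ assigns to each edge a pair $(j,J)$, with multiplicity $j\in\mathbb{Z}\setminus\{0\}$ and weight $J\in\mathbb{Z}$, such that at each vertex, with $\epsilon_r=-1$ if the $r$-th adjacent edge points toward the vertex and $\epsilon_r=1$ otherwise, $\sum_{r=1}^3\epsilon_r j_r=0$ and $\sum_{r=1}^3\epsilon_r J_r=-\prod_{r=1}^3\epsilon_r$ (admissibility conditions). A framing of $G$ is an oriented compact surface in $S^3$ containing $G$ as a deformation retract (disks at vertices, strips along edges). A framed graph is represented by a planar diagram, with the blackboard framing modified by positive and negative half-twist symbols on edges; two positive half twists equal the full twist produced by a positive kink. **The invariant $\underline{\Delta}(G,c)$ (Viro's $\mathfrak{gl}(1|1)$-Alexander polynomial).** Represent $G$ by a diagram in $\mathbb{R}^2$ in Morse position with respect to height (extrema, crossings, half twists and vertices at distinct heights), in which both strands at each crossing are directed upward, at each odd vertex the incoming edge comes from below and the two outgoing edges leave upward, and at each even vertex the two incoming edges come from below and the outgoing edge leaves upward (always achievable by planar isotopy). Choose a generic point $\delta$ on the leftmost edge (the horizontal ray from $\delta$ to the left misses the diagram), of color $(j_0,J_0)$. Crossings and vertices cut the diagram into segments. A state assigns $e_0$ or $e_1$ to each segment, with $e_0$ on the segment containing $\delta$. The weight of a state is the product of the following local (Boltzmann) weights; any local configuration not listed has weight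 $0$. - Local minimum on a segment of multiplicity $j$: directed right to left: $1$ for $e_0$, $-q^{2j}$ for $e_1$; directed left to right: $q^{-2j}$ for $e_0$, $1$ for $e_1$. - Local maximum: directed right to left: $1$ for $e_0$, $-q^{-2j}$ for $e_1$; directed left to right: $q^{2j}$ for $e_0$, $1$ for $e_1$. - Half twist on a segment colored $(j,J)$: positive $q^{-jJ}$, negative $q^{jJ}$ (for $e_0$ and $e_1$). - Crossing with strand colored $(i,I)$ from bottom left (SW) to top right (NE), and strand colored $(j,J)$ from bottom right (SE) to top left (NW). Write $(x,y)\to(z,w)$ for SW$=e_x$, SE$=e_y$, NW$=e_z$, NE$=e_w$. If the SW–NE strand is over, with $\kappa=q^{-iJ-jI}$: $(0,0)\to(0,0)$: $\kappa q^{i+j}$; $(0,1)\to(1,0)$: $\kappa q^{j-i}$; $(1,0)\to(0,1)$: $\kappa q^{i-j}$; $(1,1)\to(1,1)$: $-\kappa q^{-i-j}$; $(0,1)\to(0,1)$: $\kappa(q^{4i}-1)q^{-i-j}$. If the SE–NW strand is over, with $\kappa'=q^{iJ+jI}$: $(0,0)\to(0,0)$: $\kappa' q^{-i-j}$; $(0,1)\to(1,0)$: $\kappa' q^{i-j}$; $(1,0)\to(0,1)$: $\kappa' q^{j-i}$; $(1,1)\to(1,1)$: $-\kappa' q^{i+j}$; $(1,0)\to(1,0)$: $\kappa'(1-q^{4j})q^{-i-j}$. - Odd vertex, incoming multiplicity $k$, outgoing $i$ (left) and $j$ (right): all $e_0$: $\{2k\}_q$; incoming and left $e_1$, right $e_0$: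 $\{2i\}_q q^{-2j}$; incoming and right $e_1$, left $e_0$: $\{2j\}_q$. - Even vertex, incoming $i$ (left) and $j$ (right): all $e_0$: $1$; left and outgoing $e_1$, right $e_0$: $1$; right and outgoing $e_1$, left $e_0$: $q^{2i}$. Then $\underline{\Delta}(G,c)$ is the sum of the weights of all states multiplied by $\dfrac{q^{(-1)^{\theta}2j_0}}{q^{2j_0}-q^{-2j_0}}$, where $\theta=0$ if the edge points downward at $\delta$ and $\theta=1$ if upward. It is independent of all choices and invariant under isotopy of framed colored graphs. **Fragments.** $\mathsf{X}(i,j;a,b)$ (with $i+j=a+b$): upward edges $i$ (bottom left) and $j$ (bottom right) merge into an upward edge of multiplicity $i+j$, which splits into $a$ (top left) and $b$ (top right). $\mathsf{H}^{\leftarrow}_m(i,j)$: two upward vertical strands, with multiplicities $i$ (left) and $j$ (right) at the bottom, joined by one edge of multiplicity $m$ directed from the right strand to the left strand, so the top multiplicities are $i+m$ (left) and $j-m$ (right). $\mathsf{H}^{\rightarrow}_m(i,j)$: the same with the edge directed from the left strand to the right strand, so the top multiplicities are $i-m$ and $j+m$. **Conventions for the relations.** Diagrams in one relation are identical outside the described fragments. Omitted orientations may be filled in in any consistent way not creating sources or sinks; omitted multiplicities and weights may be filled in in any way respecting the admissibility conditions. All multiplicities are nonzero, except that an edge entirely contained in a fragment may have multiplicity zero in the following situation, where the value is formally defined: if two strands of multiplicities $i$ and $j$ are joined by an edge of multiplicity $0$ directed from the strand of multiplicity $j$ to the strand of multiplicity $i$, then the value is $\{2j\}_q$ times the value of the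 diagram with that edge deleted (the factor is $\{2m\}_q$ with $m$ the multiplicity of the strand at the tail of the zero edge); this applies when the diagram after deletion is consistently colored. *)

(* Defs.v *)
From HB Require Import structures.
From mathcomp Require Import all_boot all_order all_algebra.
From Stdlib Require Import ClassicalEpsilon.

Set Implicit Arguments.
Unset Strict Implicit.
Unset Printing Implicit Defensive.

Import Order.TTheory GRing.Theory Num.Theory.

Local Open Scope ring_scope.

(** * Planar diagrams

    A diagram in Morse position is cut by horizontal lines into layers, read
    from bottom to top; each layer is one elementary piece with vertical
    strands on both sides.  A strand met by a horizontal line is a direction
    ([true] = upward) and a color [(j, J)] (multiplicity, weight). *)

Definition strand : Type := (bool * (int * int))%type.

Definition up (j J : int) : strand := (true, (j, J)).
Definition dn (j J : int) : strand := (false, (j, J)).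

Definition upward (a : strand) : bool := a.1.
Definition mult (a : strand) : int := a.2.1.
Definition wt (a : strand) : int := a.2.2.
Definition dual (a : strand) : strand := (~~ upward a, a.2).

Inductive piece : Type :=
| Cup of strand                     (* local minimum, left leg [a] *)
| Cap of strand                     (* local maximum, left leg [a] *)
| Twist of bool & strand            (* half twist, [true] = positive *)
| Cross of bool & strand & strand   (* [true] = the SW-NE strand is over *)
| VSplit of strand & strand & strand (* one leg below, two legs above *)
| VMerge of strand & strand & strand (* two legs below, one leg above *).

Definition bottom (p : piece) : seq strand :=
  match p with
  | Cup _ => [::]
  | Cap a => [:: a; dual a]
  | Twist _ a => [:: a]
  | Cross _ a b => [:: a; b]
  | VSplit a _ _ => [:: a]
  | VMerge a b _ => [:: a; b]
  end.

Definition top (p : piece) : seq strand :=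
  match p with
  | Cup a => [:: a; dual a]
  | Cap _ => [::]
  | Twist _ a => [:: a]
  | Cross _ a b => [:: b; a]
  | VSplit _ b c => [:: b; c]
  | VMerge _ _ c => [:: c]
  end.

(** In [eps] and [vertex_ok] the direction bit of an edge tells whether it
    points away from the vertex; legs below the vertex point away from it when
    they go downward, whence the [dual]s in [piece_ok]. *)
Definition eps (a : strand) : int := if upward a then 1 else -1.

Definition vertex_ok (a b c : strand) : bool :=
  [&& ~~ [&& upward a, upward b & upward c],
      [|| upward a, upward b | upward c],
      eps a * mult a + eps b * mult b + eps c * mult c == 0
    & eps a * wt a + eps b * wt b + eps c * wt c
      == - (eps a * eps b * eps c)].

Definition piece_ok (p : piece) : bool :=
  all (fun a => mult a != 0) (bottom p ++ top p) &&
  match p with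
  | VSplit a b c => vertex_ok (dual a) b c
  | VMerge a b c => vertex_ok (dual a) (dual b) c
  | _ => true
  end.

Record layer : Type :=
  Layer { lft : seq strand; pc : piece; rgt : seq strand }.

Definition layer_bottom (l : layer) : seq strand :=
  lft l ++ bottom (pc l) ++ rgt l.
Definition layer_top (l : layer) : seq strand :=
  lft l ++ top (pc l) ++ rgt l.

Definition word : Type := seq layer.

Fixpoint typed (s : seq strand) (D : word) (t : seq strand) : bool :=
  if D is l :: D' then
    [&& s == layer_bottom l, piece_ok (pc l) & typed (layer_top l) D' t]
  else s == t.

Definition diagram (D : word) : bool := typed [::] D [::].

(** The outside of a fragment: [below] and [above] it, and the vertical
    strands to its left and to its right at the heights of the fragment. *)
Record context : Type := Context
  { below : word; outl : seq strand; outr : seq strand; above : word }.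

Definition fill (C : context) (u : word) : word :=
  below C
  ++ [seq Layer (outl C ++ lft l) (pc l) (rgt l ++ outr C) | l <- u]
  ++ above C.

(** * Planar isotopy

    The moves between words presenting isotopic planar diagrams: exchanging
    the heights of two distant pieces, straightening a strand, sliding a half
    twist over an extremum, and rotating a crossing or a vertex. *)

Definition lone (p : piece) : layer := Layer [::] p [::].

Inductive move : word -> word -> Prop :=
| move_exchange (M : seq strand) (p p' : piece) :
    move [:: Layer [::] p (M ++ bottom p'); Layer (top p ++ M) p' [::]]
         [:: Layer (bottom p ++ M) p' [::]; Layer [::] p (M ++ top p')]
| move_zigzag_left (a : strand) :
    move [:: Layer [::] (Cup a) [:: a]; Layer [:: a] (Cap (dual a)) [::]] [::]
| move_zigzag_right (a : strand) :
    move [:: Layer [:: a] (Cup (dual a)) [::]; Layer [::] (Cap a) [:: a]] [::]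
| move_twist_cup (e : bool) (a : strand) :
    move [:: lone (Cup a); Layer [::] (Twist e a) [:: dual a]]
         [:: lone (Cup a); Layer [:: a] (Twist e (dual a)) [::]]
| move_twist_cap (e : bool) (a : strand) :
    move [:: Layer [::] (Twist e a) [:: dual a]; lone (Cap a)]
         [:: Layer [:: a] (Twist e (dual a)) [::]; lone (Cap a)]
| move_cross_cap (o : bool) (a b : strand) :
    move [:: Layer [::] (Cross o a b) [:: dual a];
             Layer [:: b] (Cap a) [::]]
         [:: Layer [:: a] (Cross (~~ o) b (dual a)) [::];
             Layer [::] (Cap a) [:: b]]
| move_cross_cup (o : bool) (a b : strand) :
    move [:: Layer [:: b] (Cup a) [::];
             Layer [::] (Cross o b a) [:: dual a]]
         [:: Layer [::] (Cup a) [:: b];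
             Layer [:: a] (Cross (~~ o) (dual a) b) [::]]
| move_vertex_right (a b c : strand) :
    move [:: Layer [:: a] (Cup b) [::]; Layer [::] (VMerge a b c) [:: dual b]]
         [:: lone (VSplit a c (dual b))]
| move_vertex_left (a b c : strand) :
    move [:: Layer [::] (Cup (dual a)) [:: b];
             Layer [:: dual a] (VMerge a b c) [::]]
         [:: lone (VSplit b (dual a) c)].

Inductive isotopic : word -> word -> Prop :=
| isotopic_move (C : context) (u v : word) :
    move u v -> diagram (fill C u) -> diagram (fill C v) ->
    isotopic (fill C u) (fill C v)
| isotopic_refl (D : word) : isotopic D D
| isotopic_sym (D E : word) : isotopic D E -> isotopic E D
| isotopic_trans (D E G : word) :
    isotopic D E -> isotopic E G -> isotopic D G.

(** Both strands of a crossing, and all three edges at a vertex, go upward: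
    then [VSplit] is an odd vertex and [VMerge] an even one, in the position
    required by the state sum. *)
Definition upright (p : piece) : bool :=
  match p with
  | Cross _ _ _ | VSplit _ _ _ | VMerge _ _ _ => all upward (bottom p ++ top p)
  | _ => true
  end.

(** * The state sum

    [false] stands for e_0 and [true] for e_1. *)

Definition brace (F : fieldType) (q : F) (k : int) : F := q ^ k - q ^ (- k).

Definition min_weight (F : fieldType) (q : F) (right_to_left : bool)
    (j : int) (s : bool) : F :=
  match right_to_left, s with
  | true, false => 1
  | true, true => - q ^ (2 * j)
  | false, false => q ^ (- (2 * j))
  | false, true => 1
  end.

Definition max_weight (F : fieldType) (q : F) (right_to_left : bool)
    (j : int) (s : bool) : F :=
  match right_to_left, s with
  | true, false => 1
  | true, true => - q ^ (- (2 * j))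
  | false, false => q ^ (2 * j)
  | false, true => 1
  end.

Definition cross_weight (F : fieldType) (q : F) (over : bool)
    (a b : strand) (x y z w : bool) : F :=
  let i := mult a in let wi := wt a in
  let j := mult b in let wj := wt b in
  if over then
    q ^ (- (i * wj) - j * wi) *
    match x, y, z, w with
    | false, false, false, false => q ^ (i + j)
    | false, true, true, false => q ^ (j - i)
    | true, false, false, true => q ^ (i - j)
    | true, true, true, true => - q ^ (- i - j)
    | false, true, false, true => (q ^ (4 * i) - 1) * q ^ (- i - j)
    | _, _, _, _ => 0
    end
  else
    q ^ (i * wj + j * wi) *
    match x, y, z, w with
    | false, false, false, false => q ^ (- i - j)
    | false, true, true, false => q ^ (i - j)
    | true, false, false, true => q ^ (j - i)
    | true, true, true, true => - q ^ (i + j)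
    | true, false, true, false => (1 - q ^ (4 * j)) * q ^ (- i - j)
    | _, _, _, _ => 0
    end.

Definition odd_weight (F : fieldType) (q : F) (k i j : int)
    (x y z : bool) : F :=
  match x, y, z with
  | false, false, false => brace q (2 * k)
  | true, true, false => brace q (2 * i) * q ^ (- (2 * j))
  | true, false, true => brace q (2 * j)
  | _, _, _ => 0
  end.

Definition even_weight (F : fieldType) (q : F) (i : int)
    (x y z : bool) : F :=
  match x, y, z with
  | false, false, false => 1
  | true, false, true => 1
  | false, true, true => q ^ (2 * i)
  | _, _, _ => 0
  end.

(** The weight of a piece in terms of the labels of its bottom and top legs.
    A minimum is directed from right to left iff its left leg goes up, a
    maximum iff its left leg goes down.  Only meant for [upright] pieces. *)
Definition weight (F : fieldType) (q : F) (p : piece) (x y : seq bool) : F :=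
  match p, x, y with
  | Cup a, [::], [:: s; t] =>
      if s == t then min_weight q (upward a) (mult a) s else 0
  | Cap a, [:: s; t], [::] =>
      if s == t then max_weight q (~~ upward a) (mult a) s else 0
  | Twist e a, [:: s], [:: t] =>
      if s == t then
        if e then q ^ (- (mult a * wt a)) else q ^ (mult a * wt a)
      else 0
  | Cross o a b, [:: x1; x2], [:: y1; y2] => cross_weight q o a b x1 x2 y1 y2
  | VSplit a b c, [:: x1], [:: y1; y2] =>
      odd_weight q (mult a) (mult b) (mult c) x1 y1 y2
  | VMerge a b c, [:: x1; x2], [:: y1] => even_weight q (mult a) x1 x2 y1
  | _, _, _ => 0
  end.

Definition layer_weight (F : fieldType) (q : F) (l : layer)
    (x y : seq bool) : F :=
  let n := size (lft l) in
  let b := size (bottom (pc l)) in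
  let t := size (top (pc l)) in
  if (take n x == take n y) && (drop (n + b) x == drop (n + t) y) then
    weight q (pc l) (take b (drop n x)) (take t (drop n y))
  else 0.

(** The sum, over all labellings of the strands at all levels of [D] starting
    with [x] and ending with [y], of the product of the weights.  Since labels
    that change along a segment contribute [0], the labellings that matter are
    the states, i.e. labellings of the segments. *)
Fixpoint state_sum (F : fieldType) (q : F) (D : word) (x y : seq bool) : F :=
  if D is l :: D' then
    \sum_(z : (size (layer_top l)).-tuple bool)
       layer_weight q l x z * state_sum q D' z y
  else (x == y)%:R.

(** State sum of [D1 ++ D2], normalized, for the base point on the leftmost
    strand [a] of the level [a :: s] between [D1] and [D2]. *)
Definition based_sum (F : fieldType) (q : F) (D1 : word)
    (a : strand) (s : seq strand) (D2 : word) : F :=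
  q ^ (if upward a then - (2 * mult a) else 2 * mult a) / brace q (2 * mult a)
  * \sum_(z : (size (a :: s)).-tuple bool | head true z == false)
       state_sum q D1 [::] z * state_sum q D2 z [::].

(** [v] is computed from some admissible Morse position of [D] and some base
    point. *)
Definition Delta_value (F : fieldType) (q : F) (D : word) (v : F) : Prop :=
  exists (D1 D2 : word) (a : strand) (s : seq strand),
    [/\ isotopic D (D1 ++ D2),
        all (fun l => upright (pc l)) (D1 ++ D2),
        typed [::] D1 (a :: s), typed (a :: s) D2 [::]
      & v = based_sum q D1 a s D2].

(** The value for a choice of Morse position and base point; the invariance
    theorem for the state sum says that the choice is immaterial. *)
Definition Delta (F : fieldType) (q : F) (D : word) : F :=
  epsilon (inhabits 0) (Delta_value q D).

(** * Disconnected diagrams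

    [c n] lists, for some splitting of the diagram into two disjoint parts,
    the part containing each strand at level [n]. *)
Definition disconnected (D : word) : Prop :=
  exists c : nat -> seq bool,
    [/\ c 0%N = [::],
        forall n, (n < size D)%N ->
          let l := nth (lone (Cup (up 1 0))) D n in
          exists (x y : seq bool) (b : bool),
            [/\ size x = size (lft l), size y = size (rgt l),
                c n = x ++ nseq (size (bottom (pc l))) b ++ y
              & c n.+1 = x ++ nseq (size (top (pc l))) b ++ y],
        exists2 n, (n <= size D)%N & true \in c n
      & exists2 n, (n <= size D)%N & false \in c n].

(** * Fragments

    A formal fragment [(r, u)] has value [r] times that of [u]; it encodes the
    value given by convention to fragments with edges of multiplicity zero.
    If the strands left after deleting a zero edge are not consistently
    colored, filling a context with [u] is not a [diagram]. *)

Definition fragment (F : fieldType) : Type := (F * word)%type.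

Definition bracket (F : fieldType) (q : F) (C : context) (f : fragment F) : F :=
  f.1 * Delta q (fill C f.2).

Definition stack (F : fieldType) (f g : fragment F) : fragment F :=
  (f.1 * g.1, f.2 ++ g.2).

Definition circle (a : strand) : word := [:: lone (Cup a); lone (Cap a)].

Definition crossing (o : bool) (a b : strand) : word := [:: lone (Cross o a b)].

Definition half_twist (e : bool) (a : strand) : word := [:: lone (Twist e a)].

(** In the following, [bl], [br], [tl], [tr] are the bottom left, bottom right,
    top left and top right ends, and the other arguments inner edges. *)

Definition Xfrag (bl br m tl tr : strand) : word :=
  [:: lone (VMerge bl br m); lone (VSplit m tl tr)].

Definition Hleft (F : fieldType) (q : F) (bl br m tl tr : strand) :
    fragment F :=
  if mult m == 0 then (brace q (2 * mult br), [::])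
  else (1, [:: Layer [:: bl] (VSplit br m tr) [::];
               Layer [::] (VMerge bl m tl) [:: tr]]).

Definition Hright (F : fieldType) (q : F) (bl br m tl tr : strand) :
    fragment F :=
  if mult m == 0 then (brace q (2 * mult bl), [::])
  else (1, [:: Layer [::] (VSplit bl tl m) [:: br];
               Layer [:: tl] (VMerge m br tr) [::]]).

(** [x] and [y] are the left and right arcs; if one of them is zero, the
    other one must continue the edge [e]. *)
Definition bubble (F : fieldType) (q : F) (e x y : strand) : fragment F :=
  if ((mult x == 0) && (y == e)) || ((mult y == 0) && (x == e)) then
    (brace q (2 * mult e), [::])
  else (1, [:: lone (VSplit e x y); lone (VMerge x y e)]).

(** [el], [er] are the left and right ends (same color below and above). *)
Definition square (el er ab da bc cd : strand) : word :=
  [:: Layer [::] (VSplit el da ab) [:: er];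
      Layer [:: da] (VMerge ab er bc) [::];
      Layer [:: da] (VSplit bc cd er) [::];
      Layer [::] (VMerge da cd el) [:: er]].

Definition vertical_bar (F : fieldType) (q : F) (el er rp : strand) :
    fragment F :=
  if mult rp == 0 then
    (brace q (2 * mult er), [:: lone (Cap el); lone (Cup el)])
  else (1, [:: lone (VMerge el er rp); lone (VSplit rp el er)]).

(** Lower rung [k] to the left, upper rung [l] to the right.  If the middle
    right edge [mr] is zero, deleting it leaves the strand [br], [k], which
    merges with [bl], and the strand [l], [tr], which splits off [ml]. *)
Definition ladder (F : fieldType) (q : F)
    (bl br k ml mr l tl tr : strand) : fragment F :=
  if mult mr == 0 then (brace q (2 * mult br), Xfrag bl k ml tl l)
  else stack (Hleft q bl br k ml mr) (Hright q ml mr l tl tr).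

Definition split_left (s e x y z : strand) : word :=
  [:: lone (VSplit s e z); Layer [::] (VSplit e x y) [:: z]].

Definition split_right (s e x y z : strand) : word :=
  [:: lone (VSplit s x e); Layer [:: x] (VSplit e y z) [::]].

Definition merge_left (x y z e s : strand) : word :=
  [:: Layer [::] (VMerge x y e) [:: z]; lone (VMerge e z s)].

Definition merge_right (x y z e s : strand) : word :=
  [:: Layer [:: x] (VMerge y z e) [::]; lone (VMerge x e s)].

(* Main.v *)
Require Import Defs.
From HB Require Import structures.
From mathcomp Require Import all_boot all_order all_algebra.
From mathcomp Require Import ring zify.
From Stdlib Require Import ClassicalEpsilon FunctionalExtensionality.

Set Implicit Arguments.
Unset Strict Implicit.
Unset Printing Implicit Defensive.

Import Order.TTheory GRing.Theory Num.Theory.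

Local Open Scope ring_scope.

(** The state sum is extended to all Morse positions by giving rotated crossings
    and vertices the weights forced by the isotopy moves, so that [Delta] can be
    evaluated on any word presenting the diagram.  Every elementary piece then
    commutes with the odd generators E and F of the quantum group of gl(1|1);
    this symmetry makes the based state sum independent of the base point, and,
    applied to one part of a disconnected diagram only, makes it vanish there.
    Since every word is isotopic to an upright one, [Delta] is this state sum,
    and the remaining relations are identities between the operators of small
    fragments. *)

(** An isotopy between two upright positions may pass through words that are not upright, so
    invariance can be checked move by move only once every word has a value. The base point cannot
    be dispensed with, since without it the state sum of a closed diagram vanishes. A strand of
    multiplicity $j$ carries a two-dimensional module on which $EF+FE$ is the scalar $q^{\pm 4j}-1$,
    nonzero because $j\neq 0$ and $q$ is not a root of unity. Divided by this scalar, $EF$ of that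
    strand is the projection to one label, which is what the base point inserts, and the normalizing
    factor of the invariant is, up to sign, the inverse of the same scalar. Freedom in the choice of
    the base point allows it to be put just outside a fragment, which turns moves and relations into
    identities between matrices of fragments. *)

Lemma dualK (a : strand) : dual (dual a) = a.
Proof. by case: a => u [j J]; rewrite /dual /= negbK. Qed.

(** * Sums over labellings and the extended weights *)

Section StateSum.
Variables (F : fieldType) (q : F).

Implicit Types (phi psi : seq bool -> F) (x y t : seq bool).

(** By recursion on the length, so that sums over the labels of a concrete piece unfold by
    computation; [sum_tuple_bool] compares it with the sums in the definition of the state sum. *)
Fixpoint bsum (n : nat) (f : seq bool -> F) : F :=
  if n is n'.+1 then
    bsum n' (fun t => f (false :: t)) + bsum n' (fun t => f (true :: t))
  else f [::].

Lemma eq_bsum n f g :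
  (forall t, size t = n -> f t = g t) -> bsum n f = bsum n g.
Proof.
elim: n f g => [|n IHn] f g fg /=; first exact: fg.
by congr (_ + _); apply: IHn => t tn; apply: fg; rewrite /= tn.
Qed.

Lemma bsum_lin n (c d : F) f g :
  bsum n (fun t => c * f t + d * g t) = c * bsum n f + d * bsum n g.
Proof. by elim: n f g => [|n IHn] f g //=; rewrite !IHn; ring. Qed.

Lemma bsumZ n (c : F) f : bsum n (fun t => c * f t) = c * bsum n f.
Proof. by elim: n f => [|n IHn] f //=; rewrite !IHn mulrDr. Qed.

Lemma bsum_cat n m f :
  bsum (n + m) f = bsum n (fun t => bsum m (fun u => f (t ++ u))).
Proof. by elim: n f => [|n IHn] f //=; rewrite !IHn. Qed.

Lemma bsum0 n : bsum n (fun=> 0) = 0.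
Proof. by elim: n => [|n IHn] //=; rewrite IHn addr0. Qed.

Lemma bsum_delta n x f :
  size x = n -> bsum n (fun t => (x == t)%:R * f t) = f x.
Proof.
elim: n x f => [|n IHn] [|b x] f //=; first by rewrite mul1r.
case=> xn; under eq_bsum => t _ do rewrite eqseq_cons.
under [X in _ + X]eq_bsum => t _ do rewrite eqseq_cons.
case: b; rewrite /= ?(IHn x (fun t => f (_ :: t))) //.
  under eq_bsum => t _ do rewrite mul0r.
  by rewrite bsum0 add0r.
under [X in _ + X]eq_bsum => t _ do rewrite mul0r.
by rewrite bsum0 addr0.
Qed.

Lemma sum_tuple_bool n (f : seq bool -> F) :
  \sum_(z : n.-tuple bool) f z = bsum n f.
Proof.
elim: n f => [|n IHn] f.
  by rewrite (bigD1 [tuple]) //= big1 ?addr0 // => z /eqP[]; apply: tuple0.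
rewrite (reindex (fun u : bool * n.-tuple bool => [tuple of u.1 :: u.2])) /=.
  rewrite -(pair_big xpredT xpredT
    (fun b (t : n.-tuple bool) => f (b :: t))) /= big_bool /= addrC -!IHn.
  by [].
exists (fun z : n.+1.-tuple bool => (thead z, [tuple of behead z])).
  by case=> b t _ /=; congr pair; apply: val_inj.
by move=> z _; case/tupleP: z => b t; apply: val_inj.
Qed.

Definition cup (a : strand) (s : bool) : F :=
  min_weight q (upward a) (mult a) s.
Definition cap (a : strand) (s : bool) : F :=
  max_weight q (~~ upward a) (mult a) s.

(* The weights of rotated crossings and vertices are forced by the moves
   [move_cross_cap], [move_vertex_right] and [move_vertex_left]. *)
Definition xcross (o : bool) (a b : strand) (x y z w : bool) : F :=
  match upward a, upward b with
  | true, true => cross_weight q o a b x y z w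
  | false, true =>
      cup (dual a) w * cap a x * cross_weight q (~~ o) b (dual a) y w x z
  | true, false =>
      cup b z * cap (dual b) y * cross_weight q (~~ o) (dual b) a z x w y
  | false, false =>
      cup (dual a) w * cap a x * (cup (dual b) z * cap b y) *
      cross_weight q o (dual a) (dual b) w z y x
  end.

Definition xmerge (a b c : strand) (x y z : bool) : F :=
  match upward a, upward b, upward c with
  | true, true, true => even_weight q (mult a) x y z
  | true, false, true =>
      cap (dual b) y * odd_weight q (mult a) (mult c) (mult b) x z y
  | false, true, true =>
      cap a x * odd_weight q (mult b) (mult a) (mult c) y x z
  | true, false, false =>
      cup c z * cap (dual b) y * even_weight q (mult c) z x y
  | false, true, false =>
      cup (dual c) z * cap a x * even_weight q (mult b) y z x
  | false, false, false =>
      cup c z * cap (dual a) x * cap (dual b) y *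
      odd_weight q (mult c) (mult b) (mult a) z y x
  | _, _, _ => 0
  end.

(** [move_vertex_right] holds by this definition; [move_vertex_left] becomes the identity
    [xmerge_left]. *)
Definition xsplit (a b c : strand) (x y z : bool) : F :=
  cup (dual c) z * xmerge a (dual c) b x z y.

Definition xweight (p : piece) (x y : seq bool) : F :=
  match p, x, y with
  | Cup a, [::], [:: s; t] => if s == t then cup a s else 0
  | Cap a, [:: s; t], [::] => if s == t then cap a s else 0
  | Twist e a, [:: s], [:: t] =>
      if s == t then
        if e then q ^ (- (mult a * wt a)) else q ^ (mult a * wt a)
      else 0
  | Cross o a b, [:: x1; x2], [:: y1; y2] => xcross o a b x1 x2 y1 y2
  | VSplit a b c, [:: x1], [:: y1; y2] => xsplit a b c x1 y1 y2
  | VMerge a b c, [:: x1; x2], [:: y1] => xmerge a b c x1 x2 y1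
  | _, _, _ => 0
  end.

Lemma xweight_upright (q0 : q != 0) p x y :
  upright p -> weight q p x y = xweight p x y.
Proof.
case: p => [a|a|e a|o a b|a b c|a b c] //=.
- by case/and5P=> ua ub _ _ _; case: x => [|? [|? [|? ?]]] //;
     case: y => [|? [|? [|? ?]]] //; rewrite /xcross ua ub.
- case/and4P=> ua ub uc _; case: x => [|x [|? ?]] //.
  case: y => [|y [|z [|? ?]]] //; rewrite /xsplit /xmerge ua ub /= uc /=.
  rewrite dualK mulrA /cup /cap /= uc /= /mult /=.
  (* The right leg is bent down and up again, and its two extremum weights cancel. *)
  suff -> : min_weight q false c.2.1 z * max_weight q false c.2.1 z = 1.
    by rewrite mul1r.
  by case: z => /=; rewrite ?mul1r // -expfzDr // addNr expr0z.
case/and4P=> ua ub uc _; case: x => [|x [|? [|? ?]]] //.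
by case: y => [|y [|? ?]] //; rewrite /xmerge ua ub uc.
Qed.

(** * Transfer operators *)

(** The transfer matrix acts contravariantly: functions of the labelling above become functions of
    the labelling below. Labels beyond the legs pass unchanged, so strands to the right need no
    treatment. *)
Definition pull_piece (p : piece) phi x : F :=
  let m := size (bottom p) in
  bsum (size (top p)) (fun t => xweight p (take m x) t * phi (t ++ drop m x)).

Definition pull_layer (l : layer) phi x : F :=
  let n := size (lft l) in
  pull_piece (pc l) (fun y => phi (take n x ++ y)) (drop n x).

Fixpoint pull (D : word) phi : seq bool -> F :=
  if D is l :: D' then pull_layer l (pull D' phi) else phi.

Lemma pull_cat D1 D2 phi : pull (D1 ++ D2) phi = pull D1 (pull D2 phi).
Proof. by elim: D1 => //= l D1 ->. Qed.

Lemma pull_layer_lin l (c d : F) phi psi x :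
  pull_layer l (fun y => c * phi y + d * psi y) x
  = c * pull_layer l phi x + d * pull_layer l psi x.
Proof.
rewrite /pull_layer /pull_piece -bsum_lin; apply: eq_bsum => t _; ring.
Qed.

Lemma pull_lin D (c d : F) phi psi x :
  pull D (fun y => c * phi y + d * psi y) x
  = c * pull D phi x + d * pull D psi x.
Proof.
elim: D x => [//|l D IHD] x /=; rewrite -pull_layer_lin.
by congr (pull_layer l _ x); apply: functional_extensionality => y.
Qed.

Lemma pullZ D (c : F) phi x :
  pull D (fun y => c * phi y) x = c * pull D phi x.
Proof.
have := pull_lin D c 0 phi phi x; rewrite mul0r addr0 => <-.
by congr (pull D _ x); apply: functional_extensionality => y;
   rewrite mul0r addr0.
Qed.

Lemma pullD D phi psi x :
  pull D (fun y => phi y + psi y) x = pull D phi x + pull D psi x.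
Proof.
have := pull_lin D 1 1 phi psi x; rewrite !mul1r => <-.
by congr (pull D _ x); apply: functional_extensionality => y; rewrite !mul1r.
Qed.

Lemma eq_pull_layer l phi psi x :
  size x = size (layer_bottom l) ->
  (forall y, size y = size (layer_top l) -> phi y = psi y) ->
  pull_layer l phi x = pull_layer l psi x.
Proof.
rewrite /layer_bottom /layer_top !size_cat => sx e.
rewrite /pull_layer /pull_piece; apply: eq_bsum => t st; congr (_ * _).
apply: e; rewrite !size_cat size_takel ?sx ?leq_addr // !size_drop sx st.
by rewrite !addKn.
Qed.

(** [pull] looks only at labellings of the right length; the identities rewritten under it hold only
    for these. *)
Lemma eq_pull s D s' phi psi x :
  typed s D s' -> size x = size s ->
  (forall y, size y = size s' -> phi y = psi y) ->
  pull D phi x = pull D psi x.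
Proof.
elim: D s x => [|l D IHD] s x /=; first by move=> /eqP -> sx; apply.
case/and3P=> /eqP -> _ tD sx e; apply: eq_pull_layer => // y sy.
exact: IHD tD sy e.
Qed.

Lemma layer_weight_cat l x1 x2 x3 y1 y2 y3 :
  upright (pc l) -> q != 0 ->
  size x1 = size (lft l) -> size x2 = size (bottom (pc l)) ->
  size y1 = size (lft l) -> size y2 = size (top (pc l)) ->
  layer_weight q l (x1 ++ x2 ++ x3) (y1 ++ y2 ++ y3)
  = (x1 == y1)%:R * ((x3 == y3)%:R * xweight (pc l) x2 y2).
Proof.
move=> up q0 s1 s2 t1 t2; rewrite /layer_weight.
have -> : drop (size (lft l) + size (bottom (pc l))) (x1 ++ x2 ++ x3) = x3.
  by rewrite catA drop_size_cat // size_cat s1 s2.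
have -> : drop (size (lft l) + size (top (pc l))) (y1 ++ y2 ++ y3) = y3.
  by rewrite catA drop_size_cat // size_cat t1 t2.
rewrite !take_size_cat // !drop_size_cat // !take_size_cat //.
rewrite xweight_upright //.
by case: (x1 == y1); case: (x3 == y3); rewrite /= ?mul1r ?mul0r.
Qed.

Lemma sum_layer_weight l phi x :
  upright (pc l) -> q != 0 -> size x = size (layer_bottom l) ->
  \sum_(z : (size (layer_top l)).-tuple bool) layer_weight q l x z * phi z
  = pull_layer l phi x.
Proof.
move=> up q0; rewrite /layer_bottom !size_cat => sx.
rewrite (sum_tuple_bool _ (fun z => layer_weight q l x z * phi z)).
rewrite /layer_top ?size_cat !bsum_cat /pull_layer /pull_piece.
set n := size (lft l) in sx *; set m := size (bottom (pc l)) in sx *.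
set x1 := take n x; set x2 := take m (drop n x); set x3 := drop m (drop n x).
have sx1 : size x1 = n by rewrite size_takel // sx leq_addr.
have sd : size (drop n x) = (m + size (rgt l))%N by rewrite size_drop sx addKn.
have sx2 : size x2 = m by rewrite size_takel // sd leq_addr.
have sx3 : size x3 = size (rgt l) by rewrite size_drop sd addKn.
have -> : x = x1 ++ x2 ++ x3 by rewrite !cat_take_drop.
transitivity (bsum n (fun t => (x1 == t)%:R *
    bsum (size (top (pc l))) (fun u => xweight (pc l) x2 u *
      bsum (size (rgt l)) (fun w => (x3 == w)%:R * phi (t ++ u ++ w))))).
  apply: eq_bsum => t tn; rewrite bsum_cat -bsumZ; apply: eq_bsum => u un.
  rewrite -!bsumZ; apply: eq_bsum => w _.
  by rewrite layer_weight_cat // -!mulrA; ring.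
by rewrite bsum_delta //; apply: eq_bsum => u _; rewrite bsum_delta.
Qed.

Lemma sum_state_sum s D s' phi x :
  q != 0 -> all (fun l => upright (pc l)) D -> typed s D s' ->
  size x = size s ->
  \sum_(z : (size s').-tuple bool) state_sum q D x z * phi z = pull D phi x.
Proof.
move=> q0; elim: D s x => [|l D IHD] s x /=.
  move=> _ /eqP -> sx.
  by rewrite (sum_tuple_bool _ (fun z => (x == z)%:R * phi z)) bsum_delta.
case/andP=> up upD /and3P[/eqP -> _ tD] sx.
rewrite -sum_layer_weight //.
under eq_bigr => z _ do rewrite mulr_suml.
rewrite exchange_big; apply: eq_bigr => z _.
rewrite -(IHD _ _ upD tD) ?size_tuple // mulr_sumr.
by apply: eq_bigr => w _; rewrite mulrA.
Qed.

(** The state vector of the empty level: [pull D delta] sends a labelling of the bottom of [D] to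
    the state sum of [D] above it. *)
Definition delta x : F := (x == [::])%:R.

Lemma state_sum_nil s D x :
  q != 0 -> all (fun l => upright (pc l)) D -> typed s D [::] ->
  size x = size s -> state_sum q D x [::] = pull D delta x.
Proof.
move=> q0 upD tD sx; rewrite -(sum_state_sum _ q0 upD tD sx).
rewrite (bigD1 [tuple]) //= big1 ?addr0; last by move=> z /eqP[]; apply: tuple0.
by rewrite /delta eqxx mulr1.
Qed.

(** With the default [true], the empty labelling, which has no base point, gives 0. *)
Definition base0 phi x : F := if head true x then 0 else phi x.

Definition base_factor (a : strand) : F :=
  q ^ (if upward a then - (2 * mult a) else 2 * mult a) / brace q (2 * mult a).

Definition base_value (D1 : word) (a : strand) (D2 : word) : F :=
  base_factor a * pull D1 (base0 (pull D2 delta)) [::].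

Lemma based_sumE D1 a s D2 :
  q != 0 -> all (fun l => upright (pc l)) (D1 ++ D2) ->
  typed [::] D1 (a :: s) -> typed (a :: s) D2 [::] ->
  based_sum q D1 a s D2 = base_value D1 a D2.
Proof.
move=> q0; rewrite all_cat => /andP[up1 up2] t1 t2.
rewrite /based_sum /base_value -/(base_factor a); congr (_ * _).
rewrite -(sum_state_sum _ q0 up1 t1) // big_mkcond; apply: eq_bigr => z _.
rewrite /base0 (state_sum_nil q0 up2 t2) ?size_tuple //.
by case: (head true z); rewrite ?mulr0.
Qed.

End StateSum.

(** Each case is solved for one multiplicity, so that it can be substituted in the weights; sources
    and sinks give [False]. *)
Lemma vsplit_mult a b c : piece_ok (VSplit a b c) ->
  match upward a, upward b, upward c with
  | true, false, false | false, true, true => False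
  | true, true, true | false, false, false => mult a = mult b + mult c
  | true, true, false | false, false, true => mult a = mult b - mult c
  | true, false, true | false, true, false => mult a = mult c - mult b
  end.
Proof.
case: a => u [i I]; case: b => v [j J]; case: c => w [k K].
rewrite /piece_ok /= => /andP[_ /and4P[]]; rewrite /eps /mult /=.
by case: u; case: v; case: w => //= _ _ /eqP E _; lia.
Qed.

Lemma vmerge_mult a b c : piece_ok (VMerge a b c) ->
  match upward a, upward b, upward c with
  | true, true, false | false, false, true => False
  | true, true, true | false, false, false => mult c = mult a + mult b
  | true, false, true | false, true, false => mult c = mult a - mult b
  | false, true, true | true, false, false => mult c = mult b - mult a
  end.
Proof.
case: a => u [i I]; case: b => v [j J]; case: c => w [k K].
rewrite /piece_ok /= => /andP[_ /and4P[]]; rewrite /eps /mult /=.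
by case: u; case: v; case: w => //= _ _ /eqP E _; lia.
Qed.

(** * Identities between powers of q *)

Section Powers.
Variables (F : fieldType) (q : F).
Hypothesis q_neq0 : q != 0.

Lemma exprz2 (m : int) : q ^ (2 * m) = (q ^ m) ^+ 2.
Proof. by rewrite mulrC -exprz_exp. Qed.

Lemma exprz4 (m : int) : q ^ (4 * m) = (q ^ m) ^+ 4.
Proof. by rewrite mulrC -exprz_exp. Qed.

Lemma exprzDm (m n : int) : q ^ (m + n) = q ^ m * q ^ n.
Proof. exact: expfzDr. Qed.

Lemma exprzN (m : int) : q ^ (- m) = (q ^ m)^-1.
Proof. by rewrite invr_expz. Qed.

End Powers.

(** Powers with linear exponents become monomials in the powers of the individual multiplicities,
    which leaves an identity of rational functions. *)
Ltac qfield q0 :=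
  rewrite /brace /mult /wt /= ?(exprz2, exprz4, exprzDm q0, exprzN);
  by field; rewrite ?expfz_neq0 ?q0 ?oner_neq0.

(** * Quantum group symmetry *)

Section Symmetry.
Variables (F : fieldType) (q : F).
Hypothesis q_neq0 : q != 0.

Implicit Types (phi psi : seq bool -> F) (x y t : seq bool).

(** A downward strand carries the dual module, hence the sign. *)
Definition charge (a : strand) : int :=
  if upward a then mult a else - mult a.

Definition tag_all (b : bool) (s : seq strand) : seq (bool * strand) :=
  [seq (b, a) | a <- s].

(** On an upward strand E takes the value at [e_1] to [e_0], and F that at [e_0] to [e_1]; on a
    downward strand the labels are exchanged. The scalar of the anticommutator is put entirely into
    E. *)
Definition coef (g : bool) (p : bool * strand) (b : bool) : F :=
  if p.1 && (b == (g (+) upward p.2))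
  then (if g then q ^ (4 * charge p.2) - 1 else 1) else 0.

Definition kcoef (p : bool * strand) (b : bool) : F :=
  if p.1 then (if b then -1 else 1) * q ^ (2 * charge p.2) else 1.

(** [act true] and [act false] are the odd generators E and F of the quantum
    group of gl(1|1): on the first strand, [coef] gives the action and [kcoef]
    the group-like factor of the coproduct E (x) 1 + K (x) E.  Strands tagged
    [false] carry the trivial representation.  As [act] stops when the list of
    strands does, [act g A] for a prefix [A] of a level acts on [A] only. *)
Fixpoint act (g : bool) (s : seq (bool * strand)) phi x : F :=
  match s, x with
  | p :: s', b :: x' =>
      coef g p b * phi (~~ b :: x')
      + kcoef p b * act g s' (fun y => phi (b :: y)) x'
  | _, _ => 0
  end.

Fixpoint kact (s : seq (bool * strand)) x : F :=
  match s, x with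
  | p :: s', b :: x' => kcoef p b * kact s' x'
  | _, _ => 1
  end.

Definition equivariant (p : piece) : Prop :=
  forall g phi x, size x = size (bottom p) ->
  bsum (size (top p))
    (fun t => xweight q p x t * act g (tag_all true (top p)) phi t)
  = act g (tag_all true (bottom p))
      (fun y => bsum (size (top p)) (fun t => xweight q p y t * phi t)) x.

Lemma cup_equivariant a : equivariant (Cup a).
Proof.
case: a => u [j J] g phi [] // _; case: u; case: g;
by rewrite /= /coef /kcoef /cup /charge /=; qfield q_neq0.
Qed.

Lemma cap_equivariant a : equivariant (Cap a).
Proof.
case: a => u [j J] g phi [|x1 [|x2 []]] // _.
by case: u; case: g; case: x1; case: x2;
   rewrite /= /coef /kcoef /cap /charge /=; qfield q_neq0.
Qed.

Lemma twist_equivariant e a : equivariant (Twist e a).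
Proof.
case: a => u [j J] g phi [|x1 []] // _.
by case: e; case: u; case: g; case: x1;
   rewrite /= /coef /kcoef /charge /=; qfield q_neq0.
Qed.

Lemma cross_equivariant o a b : equivariant (Cross o a b).
Proof.
case: a => u [i I]; case: b => v [j J] g phi [|x1 [|x2 []]] // _.
by case: o; case: u; case: v; case: g; case: x1; case: x2;
   rewrite /= /coef /kcoef /charge /xcross /cup /cap /=; qfield q_neq0.
Qed.

Lemma split_equivariant a b c :
  piece_ok (VSplit a b c) -> equivariant (VSplit a b c).
Proof.
move/vsplit_mult; case: a => u [i I]; case: b => v [j J]; case: c => w [k K].
rewrite /mult /= => E g phi [|x1 []] // _; move: E.
case: u; case: v; case: w => //= ->; case: g; case: x1;
by rewrite /= /coef /kcoef /charge /xsplit /xmerge /cup /cap /=; qfield q_neq0.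
Qed.

Lemma merge_equivariant a b c :
  piece_ok (VMerge a b c) -> equivariant (VMerge a b c).
Proof.
move/vmerge_mult; case: a => u [i I]; case: b => v [j J]; case: c => w [k K].
rewrite /mult /= => E g phi [|x1 [|x2 []]] // _; move: E.
case: u; case: v; case: w => //= ->; case: g; case: x1; case: x2;
by rewrite /= /coef /kcoef /charge /xmerge /cup /cap /=; qfield q_neq0.
Qed.

Lemma piece_equivariant p : piece_ok p -> equivariant p.
Proof.
case: p => [a|a|e a|o a b|a b c|a b c] okp.
- exact: cup_equivariant.
- exact: cap_equivariant.
- exact: twist_equivariant.
- exact: cross_equivariant.
- exact: split_equivariant.
- exact: merge_equivariant.
Qed.

End Symmetry.

(** * Symmetry of layers and words *)

Section Invariance.
Variables (F : fieldType) (q : F).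
Hypothesis q_neq0 : q != 0.

Implicit Types (phi psi : seq bool -> F) (x y t : seq bool).
Implicit Types (s X Y : seq (bool * strand)).

Local Notation act := (act q).
Local Notation kact := (kact q).
Local Notation coef := (coef q).
Local Notation kcoef := (kcoef q).
Local Notation pull := (pull q).

(** Pieces conserve charge and parity, hence commute with the group-like factor K; this lets the
    second term of the coproduct pass a piece. *)
Lemma piece_kact p x t :
  piece_ok p -> size x = size (bottom p) -> size t = size (top p) ->
  xweight q p x t * kact (tag_all true (top p)) t
  = kact (tag_all true (bottom p)) x * xweight q p x t.
Proof.
case: p => [a|a|e a|o a b|a b c|a b c] /=.
- case: a => u [j J]; case: x => // _ _; case: t => [|t1 [|t2 []]] //= _.
  by case: u; case: t1; case: t2; rewrite /kcoef /charge /=; qfield q_neq0.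
- case: a => u [j J]; case: t => //; case: x => [|x1 [|x2 []]] //= _ _ _.
  by case: u; case: x1; case: x2; rewrite /kcoef /charge /=; qfield q_neq0.
- case: a => u [j J]; case: x => [|x1 []] // _ _; case: t => [|t1 []] //= _.
  by case: x1; case: t1; rewrite /kcoef /=; ring.
- case: a => u [i I]; case: b => v [j J]; case: x => [|x1 [|x2 []]] // _ _.
  case: t => [|t1 [|t2 []]] //= _; rewrite /kcoef /=.
  by rewrite /xcross /=; case: o; case: u; case: v => /=;
     case: x1; case: x2; case: t1; case: t2 => /=; ring.
- case: a => u [i I]; case: b => v [j J]; case: c => w [k K].
  case: x => [|x1 []] // /vsplit_mult E _; move: E; rewrite /mult /=.
  case: t => [|t1 [|t2 []]] //= + _; rewrite /kcoef /charge /=.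
  rewrite /xsplit /xmerge /cup /cap.
  case: u; case: v; case: w => //= ->;
  by case: x1; case: t1; case: t2; rewrite /= ?(mulr0, mul0r); qfield q_neq0.
- case: a => u [i I]; case: b => v [j J]; case: c => w [k K].
  case: x => [|x1 [|x2 []]] // /vmerge_mult E _; move: E; rewrite /mult /=.
  case: t => [|t1 []] //= + _; rewrite /kcoef /charge /=.
  rewrite /xmerge /cup /cap.
  case: u; case: v; case: w => //= ->;
  by case: x1; case: x2; case: t1; rewrite /= ?(mulr0, mul0r); qfield q_neq0.
Qed.

Lemma act_lin g s (c d : F) phi psi x :
  act g s (fun y => c * phi y + d * psi y) x
  = c * act g s phi x + d * act g s psi x.
Proof.
elim: s x phi psi => [|p s IHs] [|b x] phi psi /=; rewrite ?mulr0 ?addr0 //.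
by rewrite IHs; ring.
Qed.

Lemma eq_act g s phi psi x :
  (forall y, size y = size x -> phi y = psi y) -> act g s phi x = act g s psi x.
Proof.
elim: s x phi psi => [|p s IHs] [|b x] phi psi //= e.
rewrite e //; congr (_ + _ * _).
by apply: IHs => // y sy; apply: e; rewrite /= sy.
Qed.

Lemma act_cat g X Y phi x y :
  size x = size X ->
  act g (X ++ Y) phi (x ++ y)
  = act g X (fun z => phi (z ++ y)) x
    + kact X x * act g Y (fun z => phi (x ++ z)) y.
Proof.
elim: X x phi => [|p X IHX] [|b x] phi //=; first by rewrite mul1r add0r.
by case=> sx; rewrite IHX //; ring.
Qed.

Lemma act_tag_false g (r : seq strand) phi x :
  act g (tag_all false r) phi x = 0.
Proof.
elim: r x phi => [|a r IHr] [|b x] phi //=.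
by rewrite IHr /coef /= mul0r mulr0 addr0.
Qed.

Lemma kact_tag_false (r : seq strand) x : kact (tag_all false r) x = 1.
Proof.
by elim: r x => [|a r IHr] [|b x] //=; rewrite IHr /kcoef /= mulr1.
Qed.

Lemma act_sum g s n (w : seq bool -> F) (f : seq bool -> seq bool -> F) x :
  act g s (fun y => bsum n (fun t => w t * f t y)) x
  = bsum n (fun t => w t * act g s (f t) x).
Proof.
elim: n w f => [|n IHn] w f /=.
  have := act_lin g s (w [::]) 0 (f [::]) (f [::]) x.
  rewrite mul0r addr0 => <-; congr (act g s _ x).
  by apply: functional_extensionality => y; rewrite mul0r addr0.
rewrite -!IHn.
set f1 := (fun y => bsum n (fun t => w (false :: t) * f (false :: t) y)).
set f2 := (fun y => bsum n (fun t => w (true :: t) * f (true :: t) y)).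
have := act_lin g s 1 1 f1 f2 x; rewrite !mul1r => <-; congr (act g s _ x).
by apply: functional_extensionality => y; rewrite !mul1r.
Qed.

Lemma tagged_piece_act g c p phi x :
  piece_ok p -> size x = size (bottom p) ->
  bsum (size (top p))
    (fun t => xweight q p x t * act g (tag_all c (top p)) phi t)
  = act g (tag_all c (bottom p))
      (fun y => bsum (size (top p)) (fun t => xweight q p y t * phi t)) x.
Proof.
case: c; first by move=> okp sx; exact: piece_equivariant.
move=> _ _; rewrite act_tag_false -(bsum0 F (size (top p))).
by apply: eq_bsum => t _; rewrite act_tag_false mulr0.
Qed.

Lemma tagged_piece_kact c p x t :
  piece_ok p -> size x = size (bottom p) -> size t = size (top p) ->
  xweight q p x t * kact (tag_all c (top p)) t
  = kact (tag_all c (bottom p)) x * xweight q p x t.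
Proof.
by case: c; [exact: piece_kact | rewrite !kact_tag_false mulr1 mul1r].
Qed.

(** By the coproduct, the part acting on the legs passes by equivariance, and the part acting to
    their right because the piece commutes with K. *)
Lemma pull_piece_act g c p Y phi x :
  piece_ok p -> size x = (size (bottom p) + size Y)%N ->
  pull_piece q p (act g (tag_all c (top p) ++ Y) phi) x
  = act g (tag_all c (bottom p) ++ Y) (pull_piece q p phi) x.
Proof.
move=> okp sx; set m := size (bottom p) in sx *.
have := cat_take_drop m x; set x1 := take m x; set x2 := drop m x => <-.
have s1 : size x1 = m by rewrite size_takel // sx leq_addr.
rewrite act_cat ?size_map // /pull_piece -/m.
rewrite take_size_cat // drop_size_cat //.
transitivity (
  bsum (size (top p)) (fun t => 1 * (xweight q p x1 t *
     act g (tag_all c (top p)) (fun z => phi (z ++ x2)) t) +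
     kact (tag_all c (bottom p)) x1 * (xweight q p x1 t *
       act g Y (fun z => phi (t ++ z)) x2))).
  apply: eq_bsum => t st; rewrite act_cat ?size_map //.
  by rewrite mulrDr mulrA tagged_piece_kact //; ring.
rewrite bsum_lin mul1r tagged_piece_act //; congr (_ + _ * _).
  apply: eq_act => y; rewrite s1 => sy.
  by rewrite take_size_cat ?drop_size_cat.
rewrite -act_sum; congr (act g Y _ _); apply: functional_extensionality => z.
by rewrite take_size_cat // drop_size_cat.
Qed.

(** A strand to the left contributes scalars and a change of its own label, neither of which the
    layer sees; induction on these strands reduces to the bare piece. *)
Lemma pull_layer_act g c (X Y : seq (bool * strand)) p L R phi x :
  piece_ok p -> size X = size L ->
  size x = (size L + (size (bottom p) + size Y))%N ->
  pull_layer q (Layer L p R) (act g (X ++ tag_all c (top p) ++ Y) phi) x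
  = act g (X ++ tag_all c (bottom p) ++ Y) (pull_layer q (Layer L p R) phi) x.
Proof.
move=> okp; elim: X L x phi => [|a X IHX] [|b L] x phi //=.
  move=> _ sx; rewrite /pull_layer /= drop0.
  rewrite take0 /= pull_piece_act //; congr (act _ _ _ _).
  by apply: functional_extensionality => y; rewrite take0 drop0.
case=> sX; case: x => [|e x] //= [sx].
have pullE f z : pull_layer q (Layer (b :: L) p R) f (e :: z)
  = pull_layer q (Layer L p R) (fun y => f (e :: y)) z by [].
have pullNE f z : pull_layer q (Layer (b :: L) p R) f (~~ e :: z)
  = pull_layer q (Layer L p R) (fun y => f (~~ e :: y)) z by [].
by rewrite pullE pull_layer_lin (IHX L) // pullNE.
Qed.

(** Each piece of the word carries a single tag on all its legs, whereas the
    tags of different pieces may differ. *)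
Fixpoint tag_typed s (D : word) s' : Prop :=
  if D is l :: D' then
    exists X Y c,
      [/\ size X = size (lft l), size Y = size (rgt l), piece_ok (pc l),
          s = X ++ tag_all c (bottom (pc l)) ++ Y
        & tag_typed (X ++ tag_all c (top (pc l)) ++ Y) D' s']
  else s = s'.

Lemma pull_act g s D s' phi x :
  tag_typed s D s' -> size x = size s ->
  pull D (act g s' phi) x = act g s (pull D phi) x.
Proof.
elim: D s x => [|[L p R] D IHD] s x /=; first by move=> ->.
case=> X [Y [c [/= sX sY okp -> tD]]].
rewrite !size_cat size_map sX => sx.
rewrite -(pull_layer_act g c) //; apply: eq_pull_layer => /=.
  by rewrite /layer_bottom /= !size_cat sx sY.
move=> y; rewrite /layer_top !size_cat /= => sy; apply: IHD => //.
by rewrite !size_cat size_map sX sY.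
Qed.

Lemma eq_pull_tagged s D s' phi psi x :
  tag_typed s D s' -> size x = size s ->
  (forall y, size y = size s' -> phi y = psi y) -> pull D phi x = pull D psi x.
Proof.
elim: D s x => [|l D IHD] s x /=; first by move=> -> sx; apply.
case=> X [Y [c [sX sY _ -> tD]]]; rewrite !size_cat size_map sX sY => sx e.
apply: eq_pull_layer; first by rewrite /layer_bottom !size_cat.
move=> y; rewrite /layer_top !size_cat => sy; apply: IHD tD _ e.
by rewrite !size_cat size_map sX sY.
Qed.

Lemma typed_tagged r D r' :
  typed r D r' -> tag_typed (tag_all true r) D (tag_all true r').
Proof.
elim: D r => [|l D IHD] r /=; first by move/eqP->.
case/and3P=> /eqP -> okl tD.
exists (tag_all true (lft l)), (tag_all true (rgt l)), true.
rewrite !size_map /layer_bottom /tag_all !map_cat; split=> //.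
by have := IHD _ tD; rewrite /layer_top /tag_all !map_cat.
Qed.

End Invariance.

(** * Independence of the base point *)

Section BasePoint.
Variables (F : fieldType) (q : F).
Hypothesis q_neq0 : q != 0.
Hypothesis q_nonroot : forall n : nat, (0 < n)%N -> q ^+ n != 1.

Implicit Types (phi psi v : seq bool -> F) (x y : seq bool).
Implicit Types (s A B : seq (bool * strand)) (r t : seq strand).

Local Notation act := (act q).
Local Notation pull := (pull q).
Local Notation delta := (delta F).

Lemma exprz_neq1 (m : int) : m != 0 -> q ^ m != 1.
Proof.
case: m => [n|n] m0; first by apply: q_nonroot; rewrite lt0n.
by rewrite NegzE exprzN invr_eq1; apply: q_nonroot.
Qed.

Lemma brace_neq0 (m : int) : m != 0 -> brace q m != 0.
Proof.
move=> m0; rewrite /brace exprzN subr_eq0.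
have qm : q ^ m != 0 by rewrite expfz_neq0.
rewrite -(inj_eq (mulIf qm)) mulVf // -expfzDr // exprz_neq1 //.
by rewrite -mulr2n mulrn_eq0.
Qed.

(** The scalar by which EF + FE acts on the module of one strand. *)
Definition level (a : strand) : F := q ^ (4 * charge a) - 1.

Lemma level_neq0 a : mult a != 0 -> level a != 0.
Proof.
move=> m0; rewrite /level subr_eq0 exprz_neq1 // mulf_eq0 /=.
by rewrite /charge; case: (upward a); rewrite ?oppr_eq0.
Qed.

(** Telescopes to [q ^ (4 * c) - 1], where [c] is the total charge of the strands tagged [true]. *)
Fixpoint anti A : F :=
  if A is p :: A' then
    if p.1 then level p.2 + q ^ (4 * charge p.2) * anti A' else anti A'
  else 0.

Lemma act0 g s x : act g s (fun=> 0) x = 0.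
Proof.
by elim: s x => [|p s IHs] [|b x] //=; rewrite IHs !mulr0 addr0.
Qed.

Lemma actZ g s (c : F) phi x :
  act g s (fun y => c * phi y) x = c * act g s phi x.
Proof.
have := act_lin q g s c 0 phi phi x; rewrite mul0r addr0 => <-.
by congr (act g s _ x); apply: functional_extensionality => y;
   rewrite mul0r addr0.
Qed.

(** The part of the full operator on [B] is preceded by K on [A], whose sign makes it anticommute
    with the odd operator on [A]. Only the anticommutator on [A] remains, and for [g == h] it
    vanishes because the generators square to 0. *)
Lemma act_anticomm g h A B phi x :
  size x = size (A ++ B) ->
  act g A (act h (A ++ B) phi) x + act h (A ++ B) (act g A phi) x
  = if g == h then 0 else anti A * phi x.
Proof.
elim: A x phi => [|p A IHA] x phi /=.
  by rewrite act0 addr0 mul0r; case: (g == h).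
case: x => [|b x] //= [sx].
rewrite !act_lin.
have IH := IHA x (fun y => phi (b :: y)) sx.
set u := act g A (act h (A ++ B) (fun y => phi (b :: y))) x in IH *.
set w := act h (A ++ B) (act g A (fun y => phi (b :: y))) x in IH *.
have -> : w = (if g == h then 0 else anti A * phi (b :: x)) - u.
  by rewrite -IH addrAC subrr add0r.
clearbody u; clear IH w IHA.
rewrite negbK; case: p => [[] a]; rewrite /coef /kcoef /level /=.
  case: g; case: h; case: b; case: (upward a) => /=;
  rewrite ?exprz4 ?exprz2; ring.
by case: (g == h); ring.
Qed.

(** E and F act by 0 on the empty level, and the word below that level commutes with them. *)
Lemma act_closed g s D x :
  tag_typed s D [::] -> size x = size s -> act g s (pull D delta) x = 0.
Proof.
move=> tD sx; rewrite -(pull_act q_neq0 g _ tD) //.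
rewrite (_ : act g _ delta = fun y => 0 * delta y) ?pullZ ?mul0r //.
by apply: functional_extensionality => y /=; rewrite mul0r.
Qed.

Section Level.
Variables (r : seq strand) (D1 D2 : word).
Hypotheses (tD1 : typed [::] D1 r) (tD2 : typed r D2 [::]).

Local Notation s := (tag_all true r).
Local Notation v := (pull D2 delta).

Lemma act_above g x : size x = size r -> act g s v x = 0.
Proof.
by move=> sx; apply: act_closed; [exact: (typed_tagged tD2) | rewrite size_map].
Qed.

Lemma pull_below_act g phi : pull D1 (act g s phi) [::] = 0.
Proof. by rewrite (pull_act q_neq0 g _ (typed_tagged tD1)). Qed.

Lemma eq_below phi psi :
  (forall x, size x = size r -> phi x = psi x) ->
  pull D1 phi [::] = pull D1 psi [::].
Proof. by move=> e; apply: (eq_pull q tD1). Qed.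

(* E and F annihilate [v], the state sum above the level, and the linear form
   given by the state sum below the level annihilates their images.  If
   [v = E F y], commuting e and f past E and F shows that the based state sum,
   which inserts [e f] at the leftmost strand, is the value of that form at [y]
   ([base_value_potential]); this no longer depends on the strand, and [y] can
   be pulled through the layers. *)
Definition potential (y : seq bool -> F) : Prop :=
  forall x, size x = size r -> act true s (act false s y) x = v x.

End Level.

Section Base.
Variables (a : strand) (r : seq strand) (D1 D2 : word).
Hypotheses (tD1 : typed [::] D1 (a :: r)) (tD2 : typed (a :: r) D2 [::]).
Hypothesis a_neq0 : mult a != 0.

Local Notation s := (tag_all true (a :: r)).
Local Notation v := (pull D2 delta).
Local Notation e := (act true [:: (true, a)]).
Local Notation f := (act false [:: (true, a)]).
Local Notation E := (act true s).
Local Notation G := (act false s).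

Lemma anticomm g h phi x : size x = (size r).+1 ->
  act g [:: (true, a)] (act h s phi) x + act h s (act g [:: (true, a)] phi) x
  = if g == h then 0 else level a * phi x.
Proof.
move=> sx; rewrite (@act_anticomm g h [:: (true, a)] (tag_all true r)) /=.
  by rewrite mulr0 addr0.
by rewrite size_map.
Qed.

(** On a single strand [e f] is [level a] times the projection to [e_0] if the strand goes up, and
    to [e_1] if it goes down. *)
Lemma base0E x : size x = (size r).+1 ->
  base0 v x = if upward a then (level a)^-1 * e (f v) x
              else v x - (level a)^-1 * e (f v) x.
Proof.
have l0 := level_neq0 a_neq0.
case: x => [|b x] //= _; rewrite /base0 /= /coef /kcoef /= negbK.
by rewrite -/(level a); case: (upward a); case: b => /=; field.
Qed.

(** The sign for downward strands matches the complementary projection in [base0E]. *)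
Lemma base_factorE :
  base_factor q a = if upward a then (level a)^-1 else - (level a)^-1.
Proof.
have := level_neq0 a_neq0; rewrite /base_factor /level /charge /brace.
have Q0 : q ^ mult a != 0 by rewrite expfz_neq0.
case: (upward a); rewrite ?exprz4 !exprzN exprz2; set Q := q ^ mult a in Q0 *.
  have -> : Q ^+ 2 - Q ^- 2 = (Q ^+ 4 - 1) * Q ^- 2 by field.
  by move=> l0; field; rewrite l0 Q0.
have -> : Q ^+ 2 - Q ^- 2 = - (Q^-1 ^+ 4 - 1) * Q ^+ 2 by field.
move: (Q^-1 ^+ 4 - 1) => l l0; field.
by rewrite Q0 oppr_eq0 l0.
Qed.

(** As E and F kill [v], anticommuting gives [G (f v) = 0], [E (f v) = level a * v] and
    [G (e (f v)) = level a * f v]; the two factors [level a] are divided out. *)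
Lemma potential_base : potential (a :: r) D2
  (fun x => (level a)^-1 ^+ 2 * e (f v) x).
Proof.
have l0 := level_neq0 a_neq0.
have v0 g x : size x = (size r).+1 -> act g s v x = 0 by exact: (act_above tD2).
have act_zero g h psi x : size x = (size r).+1 ->
    (forall y, size y = (size r).+1 -> act h s psi y = 0) ->
    act g [:: (true, a)] (act h s psi) x = 0.
  move=> sx psi0; rewrite (@eq_act _ _ _ _ _ (fun=> 0)) ?act0 // => y.
  by rewrite sx; apply: psi0.
have Gf x : size x = (size r).+1 -> G (f v) x = 0.
  move=> sx; have := anticomm false false v sx.
  rewrite act_zero //; last by move=> y; apply: v0.
  by rewrite add0r => ->.
have Ef x : size x = (size r).+1 -> E (f v) x = level a * v x.
  move=> sx; have := anticomm false true v sx.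
  rewrite act_zero //; last by move=> y; apply: v0.
  by rewrite add0r => ->.
have Ge x : size x = (size r).+1 -> G (e (f v)) x = level a * f v x.
  move=> sx; have := anticomm true false (f v) sx.
  rewrite act_zero //.
  by rewrite add0r => ->.
move=> x sx; rewrite (@eq_act _ _ _ _ _ (fun y => (level a)^-1 * f v y)).
  rewrite actZ Ef //; field; exact: l0.
move=> y; rewrite sx => sy; rewrite actZ Ge //; field; exact: l0.
Qed.

Lemma base_value_potential (y : seq bool -> F) :
  potential (a :: r) D2 y -> base_value q D1 a D2 = pull D1 y [::].
Proof.
have l0 := level_neq0 a_neq0.
move=> py; rewrite /base_value base_factorE.
have l_act g phi : pull D1 (act g s phi) [::] = 0.
  exact: (pull_below_act tD1).
have fv x : size x = (size r).+1 ->
    f v x = level a * G y x - E (f (G y)) x.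
  move=> sx; rewrite (@eq_act _ _ _ _ _ (E (G y))); last first.
    by move=> z sz; rewrite py // sz.
  have <- : f (E (G y)) x + E (f (G y)) x = level a * G y x.
    exact: anticomm.
  by rewrite addrK.
(* With [v = E (G y)], moving [f] past E and [e] past G leaves [level a ^+ 2 * y] up to images of E
   and G, which the form below the level kills. *)
have key : pull D1 (e (f v)) [::] = level a ^+ 2 * pull D1 y [::].
  transitivity (pull D1 (fun x => level a ^+ 2 * y x
      + (- level a * G (e y) x + E (e (f (G y))) x)) [::]).
    apply: (eq_below tD1) => x sx.
    rewrite (@eq_act _ _ _ _ _
      (fun z => level a * G y z + (-1) * E (f (G y)) z)).
      rewrite act_lin.
      have H1 : e (G y) x + G (e y) x = level a * y x by exact: anticomm.
      have H2 : e (E (f (G y))) x + E (e (f (G y))) x = 0 by exact: anticomm.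
      have -> : e (G y) x = level a * y x - G (e y) x by rewrite -H1 addrK.
      have -> : e (E (f (G y))) x = - E (e (f (G y))) x.
        by apply/eqP; rewrite -addr_eq0 H2.
      by ring.
    by move=> z; rewrite sx => sz; rewrite fv // mulN1r.
  by rewrite !pullD !pullZ !l_act mulr0 !addr0.
(* The sum without base point vanishes, so on a downward strand only the [e f] term of the
   projection counts. *)
have v_zero : pull D1 v [::] = 0.
  rewrite (eq_below tD1 (psi := E (G y))) ?l_act // => x sx.
  by rewrite py.
case: ifP => ua.
  rewrite (eq_below tD1 (psi := fun x => (level a)^-1 * e (f v) x)).
    by rewrite pullZ key; field.
  by move=> x sx; rewrite base0E // ua.
rewrite (eq_below tD1 (psi := fun x => v x + (- (level a)^-1) * e (f v) x)).
  by rewrite pullD pullZ key v_zero; field.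
by move=> x sx; rewrite base0E // ua mulNr.
Qed.

End Base.

Lemma typed_cat r D1 D2 r' :
  typed r (D1 ++ D2) r' <-> exists2 t, typed r D1 t & typed t D2 r'.
Proof.
elim: D1 r => [|l D1 IH] r /=.
  by split=> [tD2|[t /eqP <-]] //; exists r.
split=> [/and3P[-> -> /IH[t t1 t2]]|[t /and3P[-> -> t1] t2]].
  by exists t.
by apply/IH; exists t.
Qed.

Lemma typed_fun r D t t' : typed r D t -> typed r D t' -> t = t'.
Proof.
elim: D r => [|l D IH] r /=; first by move=> /eqP <- /eqP.
by case/and3P=> _ _ tD /and3P[_ _]; apply: IH.
Qed.

Lemma typed_mult r D t :
  typed r D t -> all (fun a => mult a != 0) r -> all (fun a => mult a != 0) t.
Proof.
elim: D r => [|l D IH] r /=; first by move/eqP->.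
case/and3P=> /eqP -> /andP[okl _] tD; rewrite /layer_bottom !all_cat.
case/and3P=> lL _ lR; apply: IH tD _; rewrite /layer_top !all_cat lL lR andbT.
by move: okl; rewrite all_cat => /andP[_ ->].
Qed.

(** A relation, since the cut may be made at any nonempty level; the word need not be upright. *)
Definition is_value (D : word) (w : F) : Prop :=
  exists D1 a r D2,
    [/\ D = D1 ++ D2, typed [::] D1 (a :: r), typed (a :: r) D2 [::]
      & w = base_value q D1 a D2].

(** A potential at the upper level, pulled back through [D2], is a potential at the lower one
    because [D2] commutes with E and F; both values are then the same number. *)
Lemma base_value_indep D1 a r D2 b t D3 :
  typed [::] D1 (a :: r) -> typed (a :: r) D2 (b :: t) ->
  typed (b :: t) D3 [::] ->
  base_value q D1 a (D2 ++ D3) = base_value q (D1 ++ D2) b D3.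
Proof.
move=> t1 t2 t3.
have t12 : typed [::] (D1 ++ D2) (b :: t) by apply/typed_cat; exists (a :: r).
have /andP[a0 _] := typed_mult t1 isT.
have /andP[b0 _] := typed_mult t12 isT.
have py := potential_base t3 b0; set y := (fun x => _) in py.
rewrite (base_value_potential t12 b0 py) pull_cat.
apply: (base_value_potential t1 a0) => x sx; rewrite pull_cat.
rewrite (@eq_act _ _ _ _ _
  (pull D2 (act false (tag_all true (b :: t)) y))); last first.
  move=> z; rewrite sx => sz.
  by rewrite (pull_act q_neq0 _ _ (typed_tagged t2)) ?size_map.
rewrite -(pull_act q_neq0 _ _ (typed_tagged t2)) ?size_map //.
exact: (eq_pull q t2).
Qed.

Lemma is_value_unique D w w' : is_value D w -> is_value D w' -> w = w'.
Proof.
suff W D1 a r D2 D1' b t D2' :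
    D = D1 ++ D2 -> typed [::] D1 (a :: r) -> typed (a :: r) D2 [::] ->
    D = D1' ++ D2' -> typed [::] D1' (b :: t) -> typed (b :: t) D2' [::] ->
    (size D1 <= size D1')%N -> base_value q D1 a D2 = base_value q D1' b D2'.
  move=> [D1 [a [r [D2 [e t1 t2 ->]]]]] [D1' [b [t [D2' [e' t1' t2' ->]]]]].
  case/orP: (leq_total (size D1) (size D1')) => le12.
    exact: (W _ _ _ _ _ _ _ _ e t1 t2 e' t1' t2' le12).
  by symmetry; exact: (W _ _ _ _ _ _ _ _ e' t1' t2' e t1 t2 le12).
move=> -> t1 t2 e t1' t2' le12.
have e1 : D1' = D1 ++ drop (size D1) D1'.
  rewrite -{1}(take_size_cat D2 (erefl (size D1))) e takel_cat //.
  by rewrite cat_take_drop.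
have e2 : D2 = drop (size D1) D1' ++ D2'.
  have := congr1 (drop (size D1)) e.
  by rewrite drop_size_cat // {1}e1 -catA drop_size_cat.
rewrite {1}e2 [in RHS]e1; apply: (base_value_indep t1 _ t2').
have := t1'; rewrite {1}e1 => /typed_cat[s ts].
by rewrite (typed_fun ts t1).
Qed.

End BasePoint.

(** * Planar isotopy *)

Definition pad (L R : seq strand) (u : word) : word :=
  [seq Layer (L ++ lft l) (pc l) (rgt l ++ R) | l <- u].

(** [ends s u t] is [typed s u t] without the admissibility conditions. *)
Fixpoint ends (s : seq strand) (u : word) (t : seq strand) : bool :=
  if u is l :: u' then (s == layer_bottom l) && ends (layer_top l) u' t
  else s == t.

Lemma typed_pad L R s u t :
  typed s u t -> typed (L ++ s ++ R) (pad L R u) (L ++ t ++ R).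
Proof.
elim: u s => [|l u IHu] s /=; first by move/eqP->.
case/and3P=> /eqP -> -> /IHu; rewrite /layer_bottom /layer_top /= -!catA.
by rewrite eqxx.
Qed.

Lemma typed_pad_inv L R s u t t1 :
  ends s u t -> typed (L ++ s ++ R) (pad L R u) t1 ->
  typed s u t /\ t1 = L ++ t ++ R.
Proof.
elim: u s => [|l u IHu] s /=; first by move/eqP-> => /eqP.
case/andP=> /eqP -> e /and3P[_ -> tu]; rewrite eqxx /=; apply: IHu => //.
by move: tu; rewrite /layer_top /= -!catA.
Qed.

Lemma fillE C u : fill C u = below C ++ pad (outl C) (outr C) u ++ above C.
Proof. by []. Qed.

Lemma fill_diagram C s u t :
  typed [::] (below C) (outl C ++ s ++ outr C) -> typed s u t ->
  typed (outl C ++ t ++ outr C) (above C) [::] -> diagram (fill C u).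
Proof.
move=> t1 t2 t3; apply/typed_cat; exists (outl C ++ s ++ outr C) => //.
by apply/typed_cat; exists (outl C ++ t ++ outr C); first exact: typed_pad.
Qed.

Lemma fill_typed_at C s u t :
  typed [::] (below C) (outl C ++ s ++ outr C) -> ends s u t ->
  diagram (fill C u) ->
  typed s u t /\ typed (outl C ++ t ++ outr C) (above C) [::].
Proof.
move=> t1 e /typed_cat[t1' /(typed_fun t1) <- /typed_cat[t2 tu ta]].
by have [? E] := typed_pad_inv e tu; rewrite -E.
Qed.

Lemma fill_level C l u : diagram (fill C (l :: u)) ->
  typed [::] (below C) (outl C ++ layer_bottom l ++ outr C).
Proof.
case/typed_cat=> t1 tb /= /and3P[/eqP E _ _].
by move: tb; rewrite E /layer_bottom /= -!catA.
Qed.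

Lemma fill_below C s l u t :
  ends s (l :: u) t -> diagram (fill C (l :: u)) ->
  typed [::] (below C) (outl C ++ s ++ outr C).
Proof. by case/andP=> /eqP -> _; apply: fill_level. Qed.

(** * Rotation identities of the extended weights *)

Section Fragments.
Variables (F : fieldType) (q : F).
Hypothesis q_neq0 : q != 0.

Implicit Types (phi psi : seq bool -> F) (x y : seq bool).

Local Notation pull := (pull q).

Lemma pull_pad L R u phi x :
  (size L <= size x)%N ->
  pull (pad L R u) phi x
  = pull u (fun y => phi (take (size L) x ++ y)) (drop (size L) x).
Proof.
elim: u x => [|l u IHu] x le; first by rewrite /= cat_take_drop.
rewrite /= /pull_layer /= size_cat drop_drop [in RHS]addnC.
congr (pull_piece q (pc l) _ _); apply: functional_extensionality => y.
rewrite takeD -catA IHu; last first.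
  by rewrite size_cat size_takel // leq_addr.
by rewrite take_size_cat ?drop_size_cat // size_takel.
Qed.

Lemma cup_cap a s : cup q a s * cap q (dual a) s = 1.
Proof.
by case: a => u [j J]; rewrite /cup /cap /=; case: u; case: s => /=;
   rewrite ?mulr1 // ?mulrNN exprzN ?mulfV ?mulVf ?expfz_neq0.
Qed.

Lemma cap_cup a s : cap q a s * cup q (dual a) s = 1.
Proof. by rewrite mulrC -{2}[a]dualK cup_cap. Qed.

(** Each orientation of a crossing got its weight from one chosen rotation; here all quarter turns
    are checked, including the one that closes the full turn. *)
Lemma xcross_cap o a b (x y z w : bool) :
  xcross q o a b x y z w * cap q a w
  = xcross q (~~ o) b (dual a) y w x z * cap q a x.
Proof.
case: a => u [i I]; case: b => v [j J].
case: o; case: u; case: v; case: x; case: y; case: z; case: w;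
by rewrite /xcross /cup /cap /= ?(mulr0, mul0r) //; qfield q_neq0.
Qed.

(** Weights of matching minima and maxima are inverse, so the rule for maxima, read for the rotated
    crossing, gives the one for minima. *)
Lemma xcross_cup o a b (x y z w : bool) :
  cup q a w * xcross q o b a x w y z
  = cup q a y * xcross q (~~ o) (dual a) b y x z w.
Proof.
have := xcross_cap (~~ o) (dual a) b y x z w; rewrite dualK negbK => E.
have c1 s : cup q a s * cap q (dual a) s = 1 := cup_cap a s.
by rewrite -[LHS]mulr1 -(c1 y) mulrACA -E -[RHS]mulr1 -(c1 w); ring.
Qed.

(** Bending up the left leg agrees with bending up the right leg of the merge that defines [xsplit];
    this needs the balance of multiplicities. *)
Lemma xmerge_left a b c (x y z : bool) :
  piece_ok (VSplit b (dual a) c) ->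
  cup q (dual a) x * xmerge q a b c x y z = xsplit q b (dual a) c y x z.
Proof.
move/vsplit_mult; case: a => u [i I]; case: b => v [j J]; case: c => w [k K].
rewrite /mult /=; case: u; case: v; case: w => //= ->;
case: x; case: y; case: z;
by rewrite /xsplit /xmerge /cup /cap /= ?(mulr0, mul0r) //; qfield q_neq0.
Qed.
End Fragments.

(** The last clause says that the fragment has an end, so that in every context a level next to it
    is nonempty and can carry the base point. *)
Lemma move_ends u v : move u v ->
  exists s t, [/\ ends s u t, ends s v t & s ++ t != [::]].
Proof.
case=> [M p p'|a|a|e a|e a|o a b|o a b|a b c|a b c].
- exists (bottom p ++ M ++ bottom p'), (top p ++ M ++ top p').
  rewrite /= /layer_bottom /layer_top /= !cats0 -!catA !eqxx; split=> //.
  by rewrite -size_eq0 !size_cat; case: p => * /=; lia.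
- by exists [:: a], [:: a]; rewrite /= /layer_bottom /layer_top /= dualK !eqxx.
- by exists [:: a], [:: a]; rewrite /= /layer_bottom /layer_top /= dualK !eqxx.
- by exists [::], [:: a; dual a]; rewrite /= /layer_bottom /layer_top /= !eqxx.
- by exists [:: a; dual a], [::]; rewrite /= /layer_bottom /layer_top /= !eqxx.
- exists [:: a; b; dual a], [:: b].
  by rewrite /= /layer_bottom /layer_top /= !eqxx.
- exists [:: b], [:: a; b; dual a].
  by rewrite /= /layer_bottom /layer_top /= !eqxx.
- exists [:: a], [:: c; dual b].
  by rewrite /= /layer_bottom /layer_top /= !eqxx.
- exists [:: b], [:: dual a; c]; rewrite /= /layer_bottom /layer_top /= dualK.
  by rewrite !eqxx.
Qed.

Ltac pull_simpl :=
  repeat progress rewrite /= /pull_layer /pull_piece /= ?(take0, drop0) /=.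

(** * Invariance of the extended state sum under the moves *)

Section MoveInvariance.
Variables (F : fieldType) (q : F).
Hypothesis q_neq0 : q != 0.
Hypothesis q_nonroot : forall n : nat, (0 < n)%N -> q ^+ n != 1.

Implicit Types (phi psi : seq bool -> F) (x y : seq bool).

Local Notation pull := (pull q).

Lemma exchange_bsum n m (f : seq bool -> seq bool -> F) :
  bsum n (fun t => bsum m (f t)) = bsum m (fun u => bsum n (fun t => f t u)).
Proof.
elim: n f => [//|n IHn] f /=; rewrite !IHn.
have := bsum_lin m 1 1 (fun u => bsum n (fun t => f (false :: t) u))
  (fun u => bsum n (fun t => f (true :: t) u)).
by rewrite !mul1r => <-; apply: eq_bsum => u _; rewrite !mul1r.
Qed.

(** The pieces act on disjoint blocks of labels, so the two sums can be interchanged. *)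
Lemma exchange_pull M p p' phi x :
  (size (bottom p ++ M ++ bottom p') <= size x)%N ->
  pull [:: Layer [::] p (M ++ bottom p'); Layer (top p ++ M) p' [::]] phi x
  = pull [:: Layer (bottom p ++ M) p' [::]; Layer [::] p (M ++ top p')] phi x.
Proof.
rewrite !size_cat => le.
set m := size (bottom p) in le *; set k := size M in le *.
have := cat_take_drop m x; set x1 := take m x; set x' := drop m x => <-.
have s1 : size x1 = m by rewrite size_takel // (leq_trans _ le) ?leq_addr.
have := cat_take_drop k x'; set x2 := take k x'; set x3 := drop k x' => <-.
have s2 : size x2 = k.
  rewrite size_takel // size_drop leq_subRL (leq_trans _ le) //.
    by rewrite addnA leq_addr.
  by rewrite leq_addr.
rewrite /= /pull_layer /= ?drop0 ?take0 /pull_piece /= !size_cat -/m -/k.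
rewrite take_size_cat // drop_size_cat //.
have tk (y1 y2 : seq bool) n : size y1 = n ->
    (take (n + k) (y1 ++ x2 ++ y2) = y1 ++ x2)
    * (drop (n + k) (y1 ++ x2 ++ y2) = y2).
  move=> sy; rewrite catA take_size_cat ?drop_size_cat //;
  by rewrite size_cat s2 sy.
under [LHS]eq_bsum => t st do rewrite !tk // -bsumZ.
rewrite exchange_bsum tk //; apply: eq_bsum => u su.
rewrite -bsumZ; apply: eq_bsum => t st.
rewrite drop0 take0 [in RHS]tk //= -!catA.
rewrite (take_size_cat _ s1) (drop_size_cat _ s1).
by rewrite -?catA; ring.
Qed.


(** [typed s v t] supplies the admissibility of the split vertex in [move_vertex_left]. *)
Lemma move_pull u v s t phi x :
  move u v -> ends s u t -> typed s v t -> (size s <= size x)%N ->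
  pull u phi x = pull v phi x.
Proof.
pose simp := (mulr0, mul0r, add0r, addr0).
case=> [M p p'|a|a|e a|e a|o a b|o a b|a b c|a b c] /=;
  rewrite /layer_bottom /= => /and3P[/eqP -> _ _].
- by move=> _; apply: exchange_pull.
- case: x => [|b x] //= _ _; pull_simpl.
  by case: b; rewrite /= ?simp mulrA cup_cap // mul1r.
- case: x => [|b x] //= _ _; pull_simpl.
  have c1 s' : cup q (dual a) s' * cap q a s' = 1 by rewrite mulrC cap_cup.
  by case: b; rewrite /= ?simp mulrA c1 mul1r.
- by move=> _ _; pull_simpl; rewrite ?simp.
- case: x => [|b [|b' x]] //= _ _.
  by case: b; case: b'; pull_simpl; rewrite ?simp //; ring.
- case: x => [|x1 [|x2 [|x3 x]]] //= _ _.
  have E z := xcross_cap q_neq0 o a b x1 x2 z x3.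
  case: x1 x3 E => [] [] /= E; pull_simpl; rewrite ?simp;
  rewrite !mulrA !E; ring.
- case: x => [|x1 x] //= _ _.
  have E (y z w : bool) := xcross_cup q_neq0 o a b x1 y z w.
  by pull_simpl; rewrite ?simp !mulrDr !mulrA !E; ring.
- case: x => [|x1 x] //= _ _; pull_simpl.
  by rewrite /xsplit !dualK ?simp; ring.
case: x => [|x1 x] //= ok _; have /and3P[_ okv _] := ok.
have E (y z w : bool) := xmerge_left q_neq0 y z w okv.
by pull_simpl; rewrite ?simp !mulrDr !mulrA !E; ring.
Qed.

Local Notation is_value := (is_value q).

Lemma base_value_below C s u t a r :
  typed [::] (below C) (a :: r) ->
  outl C ++ s ++ outr C = a :: r ->
  typed s u t -> typed (outl C ++ t ++ outr C) (above C) [::] ->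
  is_value (fill C u) (base_value q (below C) a
    (pad (outl C) (outr C) u ++ above C)).
Proof.
move=> tb e tu ta; exists (below C), a, r, (pad (outl C) (outr C) u ++ above C).
by split=> //; apply/typed_cat; exists (outl C ++ t ++ outr C);
   rewrite -?e //; apply: typed_pad.
Qed.

Lemma base_value_above C s u t a r :
  typed [::] (below C) (outl C ++ s ++ outr C) ->
  outl C ++ t ++ outr C = a :: r ->
  typed s u t -> typed (a :: r) (above C) [::] ->
  is_value (fill C u) (base_value q
    (below C ++ pad (outl C) (outr C) u) a (above C)).
Proof.
move=> tb e tu ta.
exists (below C ++ pad (outl C) (outr C) u), a, r, (above C).
split=> //; first by rewrite fillE catA.
apply/typed_cat; exists (outl C ++ s ++ outr C); rewrite -?e //.
exact: typed_pad.
Qed.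

(** With the base point on a level adjacent to the fragment, the rest of the word is common to both
    sides; uniqueness of the value covers all other base points. *)
Lemma move_is_value C u v w :
  move u v -> diagram (fill C u) -> diagram (fill C v) ->
  is_value (fill C u) w <-> is_value (fill C v) w.
Proof.
move=> mv du dv; have [s [t [eu ev st]]] := move_ends mv.
have tb : typed [::] (below C) (outl C ++ s ++ outr C).
  by case: mv eu ev du dv => *; apply: fill_below; eassumption.
have [tu ta] := fill_typed_at tb eu du.
have [tv _] := fill_typed_at tb ev dv.
set L := outl C in tb ta *; set R := outr C in tb ta *.
have pad_eq phi x : size x = size (L ++ s ++ R) ->
    pull (pad L R u) phi x = pull (pad L R v) phi x.
  rewrite !size_cat => sx; rewrite !pull_pad ?sx ?leq_addr //.
  by apply: (move_pull _ mv eu tv); rewrite size_drop sx addKn leq_addr.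
suff [w0 [vu vv]] : exists w0, is_value (fill C u) w0 /\ is_value (fill C v) w0.
  by split=> vw; [rewrite (is_value_unique q_neq0 q_nonroot vw vu)
                 |rewrite (is_value_unique q_neq0 q_nonroot vw vv)].
(* If the level below is empty, the level above is not, by [move_ends]. *)
case e1 : (L ++ s ++ R) => [|a r].
  case e2 : (L ++ t ++ R) => [|a r].
    by move: st e1 e2; case: (L) => //; case: (s) => //; case: (t).
  exists (base_value q (below C ++ pad L R u) a (above C)).
  split; first by apply: (base_value_above tb e2 tu); rewrite -e2.
  rewrite (_ : base_value _ _ _ _
    = base_value q (below C ++ pad L R v) a (above C)).
    by apply: (base_value_above tb e2 tv); rewrite -e2.
  rewrite /base_value !pull_cat; congr (_ * _).
  by apply: (eq_pull q tb) => // x sx; apply: pad_eq.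
exists (base_value q (below C) a (pad L R u ++ above C)); split.
  by apply: (base_value_below _ e1 tu ta); rewrite -e1.
rewrite (_ : base_value _ _ _ _
  = base_value q (below C) a (pad L R v ++ above C)).
  by apply: (base_value_below _ e1 tv ta); rewrite -e1.
rewrite /base_value; congr (_ * _); apply: (eq_pull q tb) => // x sx.
by rewrite /base0 !pull_cat pad_eq.
Qed.

Lemma isotopic_is_value D E w :
  isotopic D E -> is_value D w <-> is_value E w.
Proof.
move=> i; elim: i w => {D E} [C u v mv du dv|D|D E _ IH|D E G _ IH1 _ IH2] w //.
- exact: move_is_value.
- by split=> /IH.
- by split=> [/IH1/IH2|/IH2/IH1].
Qed.

End MoveInvariance.

(** * Upright positions *)

Definition upright_word (u : word) : bool := all (fun l => upright (pc l)) u.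

(** Isotopy in every context. *)
Definition frag_isotopic (s t : seq strand) (u v : word) : Prop :=
  forall C, typed [::] (below C) (outl C ++ s ++ outr C) ->
    typed (outl C ++ t ++ outr C) (above C) [::] ->
    isotopic (fill C u) (fill C v).

Lemma frag_isotopic_move s t u v :
  move u v -> typed s u t -> typed s v t -> frag_isotopic s t u v.
Proof.
by move=> mv tu tv C tb ta; apply: isotopic_move => //;
   [exact: (fill_diagram tb tu) | exact: (fill_diagram tb tv)].
Qed.

Lemma frag_isotopic_sym s t u v :
  frag_isotopic s t u v -> frag_isotopic s t v u.
Proof. by move=> i C tb ta; apply/isotopic_sym/i. Qed.

Lemma frag_isotopic_trans s t u v w :
  frag_isotopic s t u v -> frag_isotopic s t v w -> frag_isotopic s t u w.
Proof.
by move=> i j C tb ta; apply: isotopic_trans (i C tb ta) (j C tb ta).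
Qed.

Lemma pad_cat L R u v : pad L R (u ++ v) = pad L R u ++ pad L R v.
Proof. exact: map_cat. Qed.

Lemma pad_pad L R L' R' u : pad L R (pad L' R' u) = pad (L ++ L') (R' ++ R) u.
Proof. by rewrite /pad -map_comp; apply: eq_map => l /=; rewrite !catA. Qed.

(** The surrounding layers and strands are absorbed into the context. *)
Lemma frag_isotopic_pad A L R B s0 t0 s t u v :
  typed s0 A (L ++ s ++ R) -> typed (L ++ t ++ R) B t0 ->
  frag_isotopic s t u v ->
  frag_isotopic s0 t0 (A ++ pad L R u ++ B) (A ++ pad L R v ++ B).
Proof.
move=> tA tB i C tb ta.
pose C' := Context (below C ++ pad (outl C) (outr C) A) (outl C ++ L)
  (R ++ outr C) (pad (outl C) (outr C) B ++ above C).
have fillE' w : fill C (A ++ pad L R w ++ B) = fill C' w.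
  by rewrite !fillE /= !pad_cat pad_pad -!catA.
rewrite !fillE'; apply: i => /=.
  apply/typed_cat; exists (outl C ++ s0 ++ outr C) => //.
  by have := typed_pad (outl C) (outr C) tA; rewrite -!catA.
apply/typed_cat; exists (outl C ++ t0 ++ outr C) => //.
by have := typed_pad (outl C) (outr C) tB; rewrite -!catA.
Qed.

Definition straightens (p : piece) : Prop :=
  exists u, [/\ upright_word u, typed (bottom p) u (top p)
              & frag_isotopic (bottom p) (top p) [:: lone p] u].

Lemma upright_straightens p : piece_ok p -> upright p -> straightens p.
Proof.
move=> okp up; exists [:: lone p]; split; first by rewrite /= up.
  by rewrite /= /layer_bottom /layer_top /= !cats0 !eqxx okp.
by move=> C _ _; apply: isotopic_refl.
Qed.

Lemma mult_dual a : mult (dual a) = mult a. Proof. by []. Qed.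

Lemma piece_ok_cup a : piece_ok (Cup a) = (mult a != 0).
Proof. by rewrite /piece_ok /= mult_dual !andbT andbb. Qed.

Lemma piece_ok_cap a : piece_ok (Cap a) = (mult a != 0).
Proof. by rewrite /piece_ok /= mult_dual !andbT andbb. Qed.

Lemma piece_ok_cross o a b :
  piece_ok (Cross o a b) = (mult a != 0) && (mult b != 0).
Proof. by rewrite /piece_ok /= !andbT; case: eqP; case: eqP. Qed.

Lemma vertex_okC a b c : vertex_ok a b c = vertex_ok b a c.
Proof.
rewrite /vertex_ok [eps a * mult a + _]addrC [eps a * wt a + _]addrC.
by rewrite [eps a * eps b]mulrC; case: (upward a); case: (upward b).
Qed.

Lemma vertex_okAC a b c : vertex_ok a b c = vertex_ok a c b.
Proof.
rewrite /vertex_ok [_ + _ + eps c * mult c]addrAC [_ + _ + eps c * wt c]addrAC.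
by rewrite [_ * eps c]mulrAC;
   case: (upward a); case: (upward b); case: (upward c).
Qed.

Lemma piece_ok_rotr a b c :
  piece_ok (VSplit a c (dual b)) = piece_ok (VMerge a b c).
Proof.
rewrite /piece_ok /= vertex_okAC !mult_dual; congr (_ && _).
by case: (mult a == 0); case: (mult b == 0); case: (mult c == 0).
Qed.

Lemma piece_ok_rotl a b c :
  piece_ok (VSplit b (dual a) c) = piece_ok (VMerge a b c).
Proof.
rewrite /piece_ok /= vertex_okC !mult_dual; congr (_ && _).
by case: (mult a == 0); case: (mult b == 0); case: (mult c == 0).
Qed.

(** A zigzag is inserted on [a] above the crossing, its minimum slides below the crossing, and
    [move_cross_cap] rotates the crossing by a quarter turn. *)
Lemma straightens_cross o a b :
  piece_ok (Cross o a b) -> straightens (Cross (~~ o) b (dual a)) ->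
  straightens (Cross o a b).
Proof.
move=> ok [w [uw tw iw]]; have := ok; rewrite piece_ok_cross => /andP[a0 b0].
have okcup : piece_ok (Cup (dual a)) by rewrite piece_ok_cup.
have okcap : piece_ok (Cap a) by rewrite piece_ok_cap.
have okcr : piece_ok (Cross (~~ o) b (dual a)) by rewrite piece_ok_cross b0.
pose lay := (ok, okcup, okcap, okcr).
pose c1 := Layer [:: a; b] (Cup (dual a)) [::].
pose c2 := Layer [::] (Cap a) [:: b; a].
have twp := typed_pad [:: a] [:: a] tw.
have tc1 : typed [:: a; b] [:: c1] [:: a; b; dual a; a].
  by rewrite /= /layer_bottom /layer_top /= dualK !eqxx lay.
have tc2 : typed [:: a; dual a; b; a] [:: c2] [:: b; a].
  by rewrite /= /layer_bottom /layer_top /= !eqxx lay.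
exists ([:: c1] ++ pad [:: a] [:: a] w ++ [:: c2]); split.
- by rewrite /upright_word !all_cat /= andbT all_map.
- apply/typed_cat; exists [:: a; b; dual a; a] => //.
  by apply/typed_cat; exists [:: a; dual a; b; a].
apply: (frag_isotopic_trans (v :=
  [:: lone (Cross o a b); Layer [:: b; a] (Cup (dual a)) [::];
      Layer [:: b] (Cap a) [:: a]])).
  apply: (@frag_isotopic_pad [:: lone (Cross o a b)] [:: b] [::] [::]
    [:: a; b] [:: b; a] [:: a] [:: a] [::]
    [:: Layer [:: a] (Cup (dual a)) [::]; Layer [::] (Cap a) [:: a]]).
  - by rewrite /= /layer_bottom /layer_top /= !eqxx lay.
  - by rewrite /= !eqxx.
  apply/frag_isotopic_sym/frag_isotopic_move; first exact: move_zigzag_right.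
    by rewrite /= /layer_bottom /layer_top /= dualK !eqxx !lay.
  by rewrite /= !eqxx.
apply: (frag_isotopic_trans (v :=
  [:: c1; Layer [::] (Cross o a b) [:: dual a; a];
      Layer [:: b] (Cap a) [:: a]])).
  apply: (@frag_isotopic_pad [::] [::] [::] [:: Layer [:: b] (Cap a) [:: a]]
    [:: a; b] [:: b; a] [:: a; b] [:: b; a; dual a; a]
    [:: lone (Cross o a b); Layer [:: b; a] (Cup (dual a)) [::]]
    [:: c1; Layer [::] (Cross o a b) [:: dual a; a]]).
  - by rewrite /= !eqxx.
  - by rewrite /= /layer_bottom /layer_top /= !eqxx !lay.
  apply: frag_isotopic_move.
  - have := move_exchange [::] (Cross o a b) (Cup (dual a)).
    by rewrite /= dualK.
  - by rewrite /= /layer_bottom /layer_top /= dualK !eqxx !lay.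
  - by rewrite /= /layer_bottom /layer_top /= dualK !eqxx !lay.
apply: (frag_isotopic_trans (v :=
  [:: c1; Layer [:: a] (Cross (~~ o) b (dual a)) [:: a]; c2])).
  apply: (@frag_isotopic_pad [:: c1] [::] [:: a] [::]
    [:: a; b] [:: b; a] [:: a; b; dual a] [:: b]
    [:: Layer [::] (Cross o a b) [:: dual a]; Layer [:: b] (Cap a) [::]]
    [:: Layer [:: a] (Cross (~~ o) b (dual a)) [::]; Layer [::] (Cap a) [:: b]]
    tc1).
  - by rewrite /= !eqxx.
  apply: frag_isotopic_move; first exact: (move_cross_cap o a b).
  - by rewrite /= /layer_bottom /layer_top /= !eqxx !lay.
  - by rewrite /= /layer_bottom /layer_top /= !eqxx !lay.
exact: (@frag_isotopic_pad [:: c1] [:: a] [:: a] [:: c2]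
    [:: a; b] [:: b; a] [:: b; dual a] [:: dual a; b] _ _ tc1 tc2 iw).
Qed.

(** A zigzag is inserted on the leg [b], its maximum slides above the vertex, and
    [move_vertex_right] absorbs its minimum. *)
Lemma straightens_merge a b c :
  piece_ok (VMerge a b c) -> straightens (VSplit a c (dual b)) ->
  straightens (VMerge a b c).
Proof.
move=> ok [w [uw tw iw]].
have oks : piece_ok (VSplit a c (dual b)) by rewrite piece_ok_rotr.
have b0 : mult b != 0 by move: ok; rewrite /piece_ok /= => /andP[/and4P[]].
have okcup : piece_ok (Cup b) by rewrite piece_ok_cup.
have okcap : piece_ok (Cap (dual b)) by rewrite piece_ok_cap.
pose lay := (ok, oks, okcup, okcap).
pose c2 := Layer [:: c] (Cap (dual b)) [::].
have twp := typed_pad [::] [:: b] tw.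
have tc2 : typed [:: c; dual b; b] [:: c2] [:: c].
  by rewrite /= /layer_bottom /layer_top /= dualK !eqxx lay.
exists (pad [::] [:: b] w ++ [:: c2]); split.
- by rewrite /upright_word !all_cat /= andbT all_map.
- by apply/typed_cat; exists [:: c; dual b; b].
apply: (frag_isotopic_trans (v :=
  [:: Layer [:: a] (Cup b) [:: b]; Layer [:: a; b] (Cap (dual b)) [::];
      lone (VMerge a b c)])).
  apply: (@frag_isotopic_pad [::] [:: a] [::] [:: lone (VMerge a b c)]
    [:: a; b] [:: c] [:: b] [:: b] [::]
    [:: Layer [::] (Cup b) [:: b]; Layer [:: b] (Cap (dual b)) [::]]).
  - by rewrite /= !eqxx.
  - by rewrite /= /layer_bottom /layer_top /= !eqxx lay.
  apply/frag_isotopic_sym/frag_isotopic_move; first exact: move_zigzag_left.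
    by rewrite /= /layer_bottom /layer_top /= dualK !eqxx !lay.
  by rewrite /= !eqxx.
apply: (frag_isotopic_trans (v :=
  [:: Layer [:: a] (Cup b) [:: b]; Layer [::] (VMerge a b c) [:: dual b; b];
      c2])).
  apply: (@frag_isotopic_pad [:: Layer [:: a] (Cup b) [:: b]] [::] [::] [::]
    [:: a; b] [:: c] [:: a; b; dual b; b] [:: c]
    [:: Layer [:: a; b] (Cap (dual b)) [::]; lone (VMerge a b c)]
    [:: Layer [::] (VMerge a b c) [:: dual b; b]; c2]).
  - by rewrite /= /layer_bottom /layer_top /= !eqxx !lay.
  - by rewrite /= !eqxx.
  apply/frag_isotopic_sym/frag_isotopic_move.
  - have := move_exchange [::] (VMerge a b c) (Cap (dual b)).
    by rewrite /= dualK.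
  - by rewrite /= /layer_bottom /layer_top /= dualK !eqxx !lay.
  - by rewrite /= /layer_bottom /layer_top /= dualK !eqxx !lay.
apply: (frag_isotopic_trans (v :=
  [:: Layer [::] (VSplit a c (dual b)) [:: b]; c2])).
  apply: (@frag_isotopic_pad [::] [::] [:: b] [:: c2]
    [:: a; b] [:: c] [:: a] [:: c; dual b]
    [:: Layer [:: a] (Cup b) [::]; Layer [::] (VMerge a b c) [:: dual b]]
    [:: lone (VSplit a c (dual b))] _ tc2).
  - by rewrite /= !eqxx.
  apply: frag_isotopic_move; first exact: (move_vertex_right a b c).
  - by rewrite /= /layer_bottom /layer_top /= !eqxx !lay.
  - by rewrite /= /layer_bottom /layer_top /= !eqxx !lay.
apply: (@frag_isotopic_pad [::] [::] [:: b] [:: c2]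
    [:: a; b] [:: c] [:: a] [:: c; dual b] _ _ _ tc2 iw).
by rewrite /= !eqxx.
Qed.

Lemma straightens_split a b c :
  piece_ok (VSplit b (dual a) c) -> straightens (VMerge a b c) ->
  straightens (VSplit b (dual a) c).
Proof.
move=> ok [w [uw tw iw]].
have okm : piece_ok (VMerge a b c) by rewrite -piece_ok_rotl.
have a0 : mult a != 0 by move: okm; rewrite /piece_ok /= => /andP[/and4P[]].
have okcup : piece_ok (Cup (dual a)) by rewrite piece_ok_cup.
pose lay := (ok, okm, okcup).
pose c1 := Layer [::] (Cup (dual a)) [:: b].
have twp := typed_pad [:: dual a] [::] tw.
have tc1 : typed [:: b] [:: c1] [:: dual a; a; b].
  by rewrite /= /layer_bottom /layer_top /= dualK !eqxx lay.
exists ([:: c1] ++ pad [:: dual a] [::] w ++ [::]); split.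
- by rewrite /upright_word !all_cat /= andbT all_map.
- by rewrite cats0; apply/typed_cat; exists [:: dual a; a; b].
apply: (frag_isotopic_trans
  (v := [:: c1] ++ pad [:: dual a] [::] [:: lone (VMerge a b c)] ++ [::])).
  apply/frag_isotopic_sym/frag_isotopic_move; first exact: move_vertex_left.
  - by rewrite /= /layer_bottom /layer_top /= dualK !eqxx !lay.
  - by rewrite /= /layer_bottom /layer_top /= !eqxx !lay.
apply: (@frag_isotopic_pad [:: c1] [:: dual a] [::] [::]
    [:: b] [:: dual a; c] [:: a; b] [:: c] _ _ tc1 _ iw).
by rewrite /= !eqxx.
Qed.

Lemma straightens_splitE a b c : piece_ok (VSplit a b c) ->
  straightens (VMerge (dual b) a c) -> straightens (VSplit a b c).
Proof. by rewrite -{1 3}[b]dualK; apply: straightens_split. Qed.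

(** Every leg moves on by one place around the vertex; three such steps give back the vertex. *)
Lemma straightens_rot a b c : piece_ok (VMerge a b c) ->
  straightens (VMerge (dual c) a (dual b)) -> straightens (VMerge a b c).
Proof.
move=> ok st; apply: straightens_merge => //.
by apply: straightens_splitE => //; rewrite piece_ok_rotr.
Qed.

Lemma piece_ok_rot a b c :
  piece_ok (VMerge (dual c) a (dual b)) = piece_ok (VMerge a b c).
Proof. by rewrite -piece_ok_rotl dualK piece_ok_rotr. Qed.

(** Rotation permutes cyclically the three orientations of an even vertex and the three of an odd
    one; each orbit contains a position that is upright or one step away from an upright split. *)
Lemma straightens_merge_all a b c :
  piece_ok (VMerge a b c) -> straightens (VMerge a b c).
Proof.
have even a' b' c' : piece_ok (VMerge a' b' c') ->
    upward a' -> upward b' -> upward c' -> straightens (VMerge a' b' c').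
  by move=> ok ua ub uc; apply: upright_straightens; rewrite //= ua ub uc.
have odd a' b' c' : piece_ok (VMerge a' b' c') ->
    upward a' -> ~~ upward b' -> upward c' -> straightens (VMerge a' b' c').
  move=> ok ua ub uc; apply: straightens_merge => //.
  by apply: upright_straightens; rewrite ?piece_ok_rotr //= ua ub uc.
move=> ok; have := vmerge_mult ok.
case ua : (upward a); case ub : (upward b); case uc : (upward c) => // _.
- exact: even.
- by apply: odd; rewrite ?ub.
- apply: straightens_rot => //.
  by apply: even; rewrite ?piece_ok_rot //= ?uc ?ub.
- do 2 (apply: straightens_rot; rewrite ?piece_ok_rot //).
  by apply: odd; rewrite ?piece_ok_rot //= ?ua ?ub ?uc.
- do 2 (apply: straightens_rot; rewrite ?piece_ok_rot //).
  by apply: even; rewrite ?piece_ok_rot //= ?ua ?ub ?uc.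
apply: straightens_rot; rewrite ?piece_ok_rot //.
by apply: odd; rewrite ?piece_ok_rot //= ?ua ?ub ?uc.
Qed.

Lemma straightens_all p : piece_ok p -> straightens p.
Proof.
case: p => [a|a|e a|o a b|a b c|a b c] ok; try exact: upright_straightens.
- have rot o' a' b' : mult a' != 0 -> mult b' != 0 ->
    straightens (Cross (~~ o') b' (dual a')) -> straightens (Cross o' a' b').
    by move=> a0 b0; apply: straightens_cross; rewrite piece_ok_cross a0.
  move: ok; rewrite piece_ok_cross => /andP[a0 b0].
  have base o' a' b' : mult a' != 0 -> mult b' != 0 ->
    upward a' -> upward b' -> straightens (Cross o' a' b').
    move=> a0' b0' ua ub; apply: upright_straightens; last by rewrite /= ua ub.
    by rewrite piece_ok_cross a0'.
  case ua : (upward a); case ub : (upward b).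
  + exact: base.
  + do 3 (apply: (rot); rewrite ?mult_dual //).
    by apply: base; rewrite ?mult_dual //= ?ua ?ub.
  + by apply: (rot) => //; apply: base; rewrite ?mult_dual //= ua.
  + do 2 (apply: (rot); rewrite ?mult_dual //).
    by apply: base; rewrite ?mult_dual //= ?ua ?ub.
- apply: straightens_splitE => //; apply: straightens_merge_all.
  by rewrite -piece_ok_rotl dualK.
exact: straightens_merge_all.
Qed.

(** Layers are straightened from the top down; what lies above is already upright. *)
Lemma diagram_straightens D : diagram D ->
  exists2 D', isotopic D D' & upright_word D'.
Proof.
suff W D1 D2 s : typed [::] D1 s -> typed s D2 [::] -> upright_word D2 ->
    exists2 D', isotopic (D1 ++ D2) D' & upright_word D'.
  by move=> tD; have := W D [::] [::] tD isT isT; rewrite cats0.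
elim/last_ind: D1 D2 s => [|D1 l IH] D2 s t1 t2 u2.
  by exists D2 => //; apply: isotopic_refl.
move: t1; rewrite -cats1 => /typed_cat[s1 t1 /= /and3P[/eqP es okl /eqP es']].
have [w [uw tw iw]] := straightens_all okl.
pose C := Context D1 (lft l) (rgt l) D2.
have tb : typed [::] (below C) (outl C ++ bottom (pc l) ++ outr C).
  by rewrite /= -/(layer_bottom l) -es.
have ta : typed (outl C ++ top (pc l) ++ outr C) (above C) [::].
  by rewrite /= -/(layer_top l) es'.
have := iw C tb ta; rewrite !fillE /= !cats0 -catA.
have -> : Layer (lft l) (pc l) (rgt l) = l by case: (l).
move=> iso; have [] := IH (pad (lft l) (rgt l) w ++ D2) s1 t1.
- apply/typed_cat; exists (layer_top l); last by rewrite es'.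
  by rewrite es; apply: typed_pad.
- by rewrite /upright_word all_cat all_map; apply/andP; split.
by move=> D' iD' uD'; exists D' => //; apply: isotopic_trans iso iD'.
Qed.

(** * Evaluation of the invariant *)

Section Delta.
Variables (F : fieldType) (q : F).
Hypothesis q_neq0 : q != 0.
Hypothesis q_nonroot : forall n : nat, (0 < n)%N -> q ^+ n != 1.

Lemma is_value_diagram D w : is_value q D w -> diagram D.
Proof.
by case=> D1 [a [r [D2 [-> t1 t2 _]]]]; apply/typed_cat; exists (a :: r).
Qed.

(** Straightening shows that [epsilon] has a value to choose, and uniqueness that its choice is
    forced. *)
Lemma Delta_is_value D w : is_value q D w -> Delta q D = w.
Proof.
move=> vw; rewrite /Delta.
have uniq v : Delta_value q D v -> v = w.
  case=> D1 [D2 [a [r [iD uD t1 t2 ->]]]].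
  apply: (is_value_unique q_neq0 q_nonroot _ vw).
  apply/(isotopic_is_value q_neq0 q_nonroot _ iD).
  by exists D1, a, r, D2; split=> //; apply: based_sumE.
apply: uniq; apply: epsilon_spec; exists w.
have [D' iD uD] := diagram_straightens (is_value_diagram vw).
have /(isotopic_is_value q_neq0 q_nonroot _ iD) := vw.
case=> D1 [a [r [D2 [e t1 t2 ->]]]].
exists D1, D2, a, r; rewrite -e; split=> //.
by rewrite -(based_sumE q_neq0 _ t1 t2) // -e.
Qed.
End Delta.

(** * Relations between fragments *)

Section Rules.
Variables (F : fieldType) (q : F).
Hypothesis q_neq0 : q != 0.

Implicit Types (phi : seq bool -> F) (x : seq bool) (i j k wi wj wk : int).

Local Notation brace := (brace q).

Local Ltac rule :=
  rewrite /pull_piece /= ?(take0, drop0) /=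
    /xsplit /xmerge /cup /cap /= ?(mulr0, mul0r, add0r, addr0);
  qfield q_neq0.

(** The suffix lists the directions of the legs in the order of the constructor. These are the
    vertices occurring in the relations, evaluated on concrete labels to serve as rewrite rules. *)
Lemma split_uuu i j k wi wj wk phi x :
  (pull_piece q (VSplit (up k wk) (up i wi) (up j wj)) phi (false :: x)
   = brace (2 * k) * phi [:: false, false & x]) *
  (pull_piece q (VSplit (up k wk) (up i wi) (up j wj)) phi (true :: x)
   = brace (2 * i) * q ^ (- (2 * j)) * phi [:: true, false & x]
     + brace (2 * j) * phi [:: false, true & x]).
Proof. by split; rule. Qed.

Lemma split_udu i j k wi wj wk phi x :
  (pull_piece q (VSplit (up k wk) (dn i wi) (up j wj)) phi (false :: x)
   = q ^ (- (2 * i)) * phi [:: false, false & x] + phi [:: true, true & x]) *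
  (pull_piece q (VSplit (up k wk) (dn i wi) (up j wj)) phi (true :: x)
   = phi [:: false, true & x]).
Proof. by split; rule. Qed.

Lemma split_uud i j k wi wj wk phi x :
  (pull_piece q (VSplit (up k wk) (up i wi) (dn j wj)) phi (false :: x)
   = phi [:: false, false & x]
     - q ^ (2 * j + 2 * k) * phi [:: true, true & x]) *
  (pull_piece q (VSplit (up k wk) (up i wi) (dn j wj)) phi (true :: x)
   = phi [:: true, false & x]).
Proof. by split; rule. Qed.

Lemma split_dud i j k wi wj wk phi x :
  (pull_piece q (VSplit (dn k wk) (up i wi) (dn j wj)) phi (false :: x)
   = brace (2 * j) * phi [:: false, false & x]
     - q ^ (2 * j) * brace (2 * i) * phi [:: true, true & x]) *
  (pull_piece q (VSplit (dn k wk) (up i wi) (dn j wj)) phi (true :: x)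
   = brace (2 * k) * q ^ (2 * j - 2 * i - 2 * k) * phi [:: false, true & x]).
Proof. by split; rule. Qed.

Lemma merge_uuu i j k wi wj wk phi x :
  (pull_piece q (VMerge (up i wi) (up j wj) (up k wk)) phi [:: false, false & x]
   = phi (false :: x)) *
  (pull_piece q (VMerge (up i wi) (up j wj) (up k wk)) phi [:: true, false & x]
   = phi (true :: x)) *
  (pull_piece q (VMerge (up i wi) (up j wj) (up k wk)) phi [:: false, true & x]
   = q ^ (2 * i) * phi (true :: x)) *
  (pull_piece q (VMerge (up i wi) (up j wj) (up k wk)) phi [:: true, true & x]
   = 0).
Proof. by do 3?split; rule. Qed.

Lemma merge_udu i j k wi wj wk phi x :
  (pull_piece q (VMerge (up i wi) (dn j wj) (up k wk)) phi [:: false, false & x]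
   = q ^ (2 * j) * brace (2 * i) * phi (false :: x)) *
  (pull_piece q (VMerge (up i wi) (dn j wj) (up k wk)) phi [:: true, false & x]
   = brace (2 * k) * phi (true :: x)) *
  (pull_piece q (VMerge (up i wi) (dn j wj) (up k wk)) phi [:: false, true & x]
   = 0) *
  (pull_piece q (VMerge (up i wi) (dn j wj) (up k wk)) phi [:: true, true & x]
   = brace (2 * j) * phi (false :: x)).
Proof. by do 3?split; rule. Qed.

Lemma merge_duu i j k wi wj wk phi x :
  (pull_piece q (VMerge (dn i wi) (up j wj) (up k wk)) phi [:: false, false & x]
   = brace (2 * j) * phi (false :: x)) *
  (pull_piece q (VMerge (dn i wi) (up j wj) (up k wk)) phi [:: true, false & x]
   = 0) *
  (pull_piece q (VMerge (dn i wi) (up j wj) (up k wk)) phi [:: false, true & x]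
   = brace (2 * k) * phi (true :: x)) *
  (pull_piece q (VMerge (dn i wi) (up j wj) (up k wk)) phi [:: true, true & x]
   = - q ^ (- (2 * i) - 2 * k) * brace (2 * i) * phi (false :: x)).
Proof. by do 3?split; rule. Qed.

Lemma merge_udd i j k wi wj wk phi x :
  (pull_piece q (VMerge (up i wi) (dn j wj) (dn k wk)) phi [:: false, false & x]
   = q ^ (2 * j - 2 * k) * phi (false :: x)) *
  (pull_piece q (VMerge (up i wi) (dn j wj) (dn k wk)) phi [:: true, false & x]
   = 0) *
  (pull_piece q (VMerge (up i wi) (dn j wj) (dn k wk)) phi [:: false, true & x]
   = phi (true :: x)) *
  (pull_piece q (VMerge (up i wi) (dn j wj) (dn k wk)) phi [:: true, true & x]
   = phi (false :: x)).
Proof. by do 3?split; rule. Qed.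

Definition pieceE := (split_uuu, split_udu, split_uud, split_dud,
  merge_uuu, merge_udu, merge_duu, merge_udd).
End Rules.

Ltac eval_pull q0 :=
  repeat progress (rewrite /pull_layer /= ?(take0, drop0) /=;
    rewrite ?(pieceE q0) ?(mulr0, mul0r, add0r, addr0, oppr0)).

(** * The relations as identities between operators *)

Section Relations.
Variables (F : fieldType) (q : F).
Hypothesis q_neq0 : q != 0.
Hypothesis q_nonroot : forall n : nat, (0 < n)%N -> q ^+ n != 1.

Implicit Types (phi : seq bool -> F) (x : seq bool).

Definition frag_pull (f : fragment F) phi x : F := f.1 * pull q f.2 phi x.

(** With the base point just below the fragment, its strand and factor depend only on the context
    and the lower ends, hence are common to all fragments of a relation. *)
Lemma Delta_fill C b s u :
  typed [::] (below C) (outl C ++ (b :: s) ++ outr C) -> diagram (fill C u) ->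
  Delta q (fill C u) = base_value q (below C) (head b (outl C))
    (pad (outl C) (outr C) u ++ above C).
Proof.
move=> tb /typed_cat[t /(typed_fun tb) <- ta]; apply: Delta_is_value => //.
have e : outl C ++ (b :: s) ++ outr C
    = head b (outl C) :: behead (outl C ++ (b :: s) ++ outr C).
  by case: (outl C).
exists (below C), (head b (outl C)), (behead (outl C ++ (b :: s) ++ outr C)).
by exists (pad (outl C) (outr C) u ++ above C); split=> //; rewrite -e.
Qed.

(** With the base point outside, the value is linear in the operator of the fragment, so a relation
    need only be checked on labellings; [c] clears the denominators. *)
Lemma bracket_lin C b s f f1 f2 c c1 c2 :
  typed [::] (below C) (outl C ++ (b :: s) ++ outr C) ->
  diagram (fill C f.2) -> diagram (fill C f1.2) -> diagram (fill C f2.2) ->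
  c != 0 ->
  (forall phi x, (size s < size x)%N -> c * frag_pull f phi x
     = c1 * frag_pull f1 phi x + c2 * frag_pull f2 phi x) ->
  bracket q C f = c1 / c * bracket q C f1 + c2 / c * bracket q C f2.
Proof.
move=> tb d d1 d2 c0 E; apply: (mulfI c0).
have -> (X Y : F) : c * (c1 / c * X + c2 / c * Y) = c1 * X + c2 * Y by field.
rewrite /bracket !(Delta_fill tb) // /base_value.
set B := base_factor q _; rewrite !(mulrCA f.1) !(mulrCA f1.1) !(mulrCA f2.1).
rewrite !(mulrCA _ B) -mulrDr; congr (_ * _).
rewrite -!pullZ -!pullD; apply: (eq_pull q tb) => // x sx.
rewrite /base0; case: ifP => _; first by rewrite !mulr0 addr0.
have le : (size (outl C) <= size x)%N by rewrite sx size_cat leq_addr.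
rewrite !pull_cat !pull_pad //; apply: E.
by rewrite size_drop sx !size_cat addKn /= leq_addr.
Qed.

Lemma bracket_scale C b s f f1 c c1 :
  typed [::] (below C) (outl C ++ (b :: s) ++ outr C) ->
  diagram (fill C f.2) -> diagram (fill C f1.2) -> c != 0 ->
  (forall phi x, (size s < size x)%N ->
     c * frag_pull f phi x = c1 * frag_pull f1 phi x) ->
  bracket q C f = c1 / c * bracket q C f1.
Proof.
move=> tb d d1 c0 E.
rewrite (bracket_lin (f1 := f1) (f2 := f1) (c1 := c1) (c2 := 0) tb d d1 d1 c0).
  by rewrite !mul0r addr0.
by move=> phi x sx; rewrite E // mul0r addr0.
Qed.

Lemma bracket1 C u : bracket q C (1, u) = Delta q (fill C u).
Proof. by rewrite /bracket mul1r. Qed.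

Lemma Delta_half_twist C e a :
  diagram (fill C (half_twist e a)) ->
  Delta q (fill C (half_twist e a))
  = (if e then q ^ (- (mult a * wt a)) else q ^ (mult a * wt a))
    * Delta q (fill C [::]).
Proof.
move=> d; have tb := fill_level d.
have d0 : diagram (fill C [::]).
  have [tu ta] := fill_typed_at (t := [:: a]) tb (u := half_twist e a)
    ltac:(by rewrite /= /layer_bottom /layer_top /= !eqxx) d.
  exact: (fill_diagram (u := [::]) tb (eqxx _) ta).
rewrite -!bracket1.
rewrite -[X in X * _]divr1.
apply: (bracket_scale (f := (1, half_twist e a)) (f1 := (1, [::])) tb d d0)
  => [|phi [|b x] //= _]; first exact: oner_neq0.
rewrite /frag_pull !mul1r; pull_simpl.
by case: b; rewrite /= ?(mul0r, add0r, addr0).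
Qed.

Lemma fill_piece_ok C l u : diagram (fill C (l :: u)) -> piece_ok (pc l).
Proof. by case/typed_cat=> t1 _ /= /and3P[]. Qed.

Lemma Delta_bubble C i wi (a b : strand) :
  diagram (fill C (bubble q (up i wi) a b).2) -> diagram (fill C [::]) ->
  bracket q C (bubble q (up i wi) a b)
  = brace q (2 * i) * Delta q (fill C [::]).
Proof.
(* With a zero arc the claim is the convention itself. *)
rewrite /bubble; case: ifP => [//|_] d d0.
have tb := fill_level d; have := vsplit_mult (fill_piece_ok d).
rewrite -[X in _ * X]bracket1 -[X in X * _]divr1 => E.
apply: (bracket_scale (f := (1, _)) (f1 := (1, [::])) tb d d0)
  => [|phi [|e t] //= _]; first exact: oner_neq0.
rewrite /frag_pull !mul1r.
case: a b E {d tb} => u [j wj] [v [k wk]] /=; rewrite /mult /=.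
(* Two downward arcs would make the lower vertex a sink. *)
by case: u; case: v => // ->; rewrite -?/(up _ _) -?/(dn _ _);
   case: e; eval_pull q_neq0; qfield q_neq0.
Qed.

Lemma fill_tail_piece_ok C l l' u :
  diagram (fill C (l :: l' :: u)) -> piece_ok (pc l').
Proof. by case/typed_cat=> t1 _ /= /and4P[_ _ _ /andP[]]. Qed.

Lemma Delta_square C (i j wi wj wab wda wbc wcd wrp : int) :
  let DL := square (up j wj) (dn i wi)
              (up (i + j) wab) (dn i wda) (up j wbc) (up (i + j) wcd) in
  let D1 := vertical_bar q (up j wj) (dn i wi) (dn (i - j) wrp) in
  diagram (fill C DL) -> diagram (fill C D1.2) -> diagram (fill C [::]) ->
  Delta q (fill C DL)
  = brace q (2 * i + 2 * j) * bracket q C D1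
    + brace q (2 * j) ^+ 2 * Delta q (fill C [::]).
Proof.
move=> DL D1 dL d1 d0; have tb := fill_level dL.
rewrite -!(bracket1 _ DL) -(bracket1 _ [::]).
rewrite -[brace q (2 * i + _)]divr1 -[_ ^+ 2]divr1.
apply: (bracket_lin (f := (1, DL)) (f1 := D1) (f2 := (1, [::])) tb dL d1 d0)
  => [|phi [|b [|c x]] //= _]; first exact: oner_neq0.
rewrite /frag_pull !mul1r /DL /D1 /vertical_bar /=.
(* For [i = j] the bar is a zero edge, whose deletion leaves a maximum below a minimum. *)
case: ifP => [|_].
  rewrite /mult /= subr_eq0 => /eqP <-; rewrite /square.
  by case: b; case: c; eval_pull q_neq0; pull_simpl; rewrite /cup /cap /=;
     qfield q_neq0.
rewrite /square mul1r.
by case: b; case: c; eval_pull q_neq0; qfield q_neq0.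
Qed.

Lemma Delta_split_assoc C (i j k wi wj wk w wij wjk : int) :
  let s := up (i + j + k) w in
  let DL := split_left s (up (i + j) wij) (up i wi) (up j wj) (up k wk) in
  let DR := split_right s (up (j + k) wjk) (up i wi) (up j wj) (up k wk) in
  diagram (fill C DL) -> diagram (fill C DR) ->
  Delta q (fill C DL)
  = brace q (2 * i + 2 * j) / brace q (2 * j + 2 * k) * Delta q (fill C DR).
Proof.
move=> s DL DR dL dR; have tb := fill_level dL; rewrite -!bracket1.
apply: (bracket_scale (f := (1, _)) (f1 := (1, _)) tb dL dR)
  => [|phi [|b x] //= _].
  have := fill_tail_piece_ok dR; rewrite /piece_ok /= => /andP[/andP[jk _] _].
  by rewrite -mulrDr; apply: brace_neq0; rewrite ?mulf_eq0.
rewrite /frag_pull !mul1r /DL /DR /s.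
by case: b; eval_pull q_neq0; qfield q_neq0.
Qed.

Lemma Delta_merge_assoc C (i j k wi wj wk w wij wjk : int) :
  let s := up (i + j + k) w in
  let DL := merge_left (up i wi) (up j wj) (up k wk) (up (i + j) wij) s in
  let DR := merge_right (up i wi) (up j wj) (up k wk) (up (j + k) wjk) s in
  diagram (fill C DL) -> diagram (fill C DR) ->
  Delta q (fill C DL) = Delta q (fill C DR).
Proof.
move=> s DL DR dL dR; have tb := fill_level dL; rewrite -!bracket1.
rewrite -[RHS]mul1r -[X in X * _]divr1.
apply: (bracket_scale (f := (1, _)) (f1 := (1, _)) tb dL dR)
  => [|phi [|b [|c [|d x]]] //= _]; first exact: oner_neq0.
rewrite /frag_pull !mul1r /DL /DR /s.
by case: b; case: c; case: d; eval_pull q_neq0; qfield q_neq0.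
Qed.

(** One state survives the base point, and its extremum weight cancels the power of [q] in the
    normalization. *)
Lemma Delta_circle D a :
  diagram (circle a) -> isotopic D (circle a) ->
  Delta q D = (brace q (2 * mult a))^-1.
Proof.
move=> d iD; apply: Delta_is_value => //.
apply/(isotopic_is_value q_neq0 q_nonroot _ iD).
case/and4P: (d) => _ ok1 _ /andP[ok2 _].
exists [:: lone (Cup a)], a, [:: dual a], [:: lone (Cap a)].
rewrite /= /layer_bottom /layer_top /= !eqxx ok1 ok2; split=> //.
rewrite /base_value; pull_simpl.
rewrite /base0 /delta /= /base_factor /cup /cap.
have a0 : brace q (2 * mult a) != 0.
  by apply: brace_neq0; rewrite // mulf_eq0 -piece_ok_cup.
rewrite ?(mulr0, mul0r, add0r, addr0) !mulr1.
have pN : q ^ (2 * mult a) * q ^ (- (2 * mult a)) = 1.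
  by rewrite -expfzDr // subrr.
have Np : q ^ (- (2 * mult a)) * q ^ (2 * mult a) = 1 by rewrite mulrC.
by case: (upward a) => /=; rewrite ?mulr1 ?mul1r mulrAC ?pN ?Np mul1r.
Qed.

Lemma Delta_ladder C
    (i j k l wbl wbr wk wml wmr wl wtl wtr wx wh : int) :
  let bl := up i wbl in
  let br := up j wbr in
  let tl := up (i + k - l) wtl in
  let tr := up (j + l - k) wtr in
  let DL := ladder q bl br (up k wk) (up (i + k) wml) (up (j - k) wmr)
              (up l wl) tl tr in
  let X := Xfrag bl br (up (i + j) wx) tl tr in
  let H := Hleft q bl br (up (k - l) wh) tl tr in
  diagram (fill C DL.2) -> diagram (fill C X) -> diagram (fill C H.2) ->
  bracket q C DL
  = brace q (2 * j) * brace q (2 * l) / brace q (2 * j + 2 * l - 2 * k)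
    * Delta q (fill C X)
    + brace q (2 * i + 2 * k - 2 * l) * brace q (2 * j - 2 * k)
      / brace q (2 * j + 2 * l - 2 * k)
      * bracket q C H.
Proof.
move=> bl br tl tr DL X H dL dX dH; have tb := fill_level dX.
rewrite -(bracket1 _ X).
apply: (bracket_lin (f := DL) (f1 := (1, X)) (f2 := H) tb dL dX dH)
  => [|phi [|b [|c x]] //= _].
  have := fill_tail_piece_ok dX; rewrite /piece_ok /=.
  case/andP=> /and4P[_ _ tr0 _] _.
  apply: brace_neq0 => //.
  have -> : 2 * j + 2 * l - 2 * k = 2 * (j + l - k) by ring.
  by rewrite mulf_eq0.
rewrite /frag_pull /X mul1r /DL /ladder /H /bl /br /tl /tr {DL X H dL dX dH tb}.
rewrite /Hleft /Hright /mult /=.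
(* If the middle right edge is zero, the second coefficient vanishes and the ladder is by convention
   a multiple of [X]. *)
case: (eqVneq (j - k) 0) => [/eqP|jk].
  rewrite subr_eq0 => /eqP -> /=.
  have -> : brace q (2 * k - 2 * k) = 0 by rewrite /brace subrr oppr0 subrr.
  rewrite mulr0 mul0r addr0 /Xfrag.
  by case: b; case: c; eval_pull q_neq0; qfield q_neq0.
have b0 : brace q 0 = 0 by rewrite /brace oppr0 subrr.
(* A zero rung is replaced by its conventional factor; for [l = 0] the coefficient of [X] vanishes
   as well. *)
case: (eqVneq k 0) => [->|k0]; case: (eqVneq l 0) => [->|l0];
  rewrite /Xfrag ?(mulr0, addr0, subr0, sub0r).
- rewrite eqxx b0 mulr0 mul0r add0r /=.
  by case: b; case: c; eval_pull q_neq0; qfield q_neq0.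
- rewrite oppr_eq0 (negPf l0) /= mulr1.
  by case: b; case: c; eval_pull q_neq0; qfield q_neq0.
- rewrite (negPf k0) b0 mulr0 mul0r add0r /=.
  by case: b; case: c; eval_pull q_neq0; qfield q_neq0.
rewrite /= !mul1r.
case: (eqVneq (k - l) 0) => [/eqP|kl].
  rewrite subr_eq0 => /eqP -> /=.
  by case: b; case: c; eval_pull q_neq0; qfield q_neq0.
by case: b; case: c; eval_pull q_neq0; qfield q_neq0.
Qed.

End Relations.

(** * Crossing relations *)

Section CrossingRelations.
Variables (F : fieldType) (q : F).
Hypothesis q_neq0 : q != 0.
Hypothesis q_nonroot : forall n : nat, (0 < n)%N -> q ^+ n != 1.

Lemma cross_up o (i j wi wj : int) (phi : seq bool -> F) x1 x2 x :
  pull_piece q (Cross o (up i wi) (up j wj)) phi [:: x1, x2 & x]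
  = \sum_(y : bool) \sum_(z : bool)
      cross_weight q o (up i wi) (up j wj) x1 x2 y z * phi [:: y, z & x].
Proof.
by rewrite !big_bool /pull_piece /= ?take0 ?drop0 /xcross /=; ring.
Qed.

Lemma Delta_crossing_left C o (i j wi wj wx wh : int) :
  let a := up i wi in
  let b := up j wj in
  let X := Xfrag a b (up (i + j) wx) b a in
  let H := Hleft q a b (up (j - i) wh) b a in
  diagram (fill C (crossing o a b)) -> diagram (fill C X) ->
  diagram (fill C H.2) ->
  Delta q (fill C (crossing o a b))
  = (if o then q ^ (i - j - i * wj - j * wi)
     else q ^ (j - i + i * wj + j * wi)) / brace q (2 * i)
      * Delta q (fill C X)
    - (if o then q ^ (- i - j - i * wj - j * wi)
       else q ^ (i + j + i * wj + j * wi)) / brace q (2 * i)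
      * bracket q C H.
Proof.
move=> a b X H dD dX dH; have tb := fill_level dD.
have negE (y z t : F) : - (y / z * t) = (- y) / z * t by rewrite !mulNr.
rewrite -!bracket1 negE.
apply: (bracket_lin q_neq0 q_nonroot (f := (1, crossing o a b))
  (f1 := (1, X)) (f2 := H) tb dD dX dH) => [|phi [|x1 [|x2 x]] //= _].
  have := fill_piece_ok dD; rewrite piece_ok_cross => /andP[i0 _].
  by apply: brace_neq0; rewrite // mulf_eq0.
rewrite /frag_pull !mul1r /X /H /Hleft /Xfrag /a /b {1}/mult /=.
rewrite /pull_layer /= ?take0 ?drop0 cross_up !big_bool /=.
(* For equal multiplicities the rung is a zero edge and [H] is a multiple of two vertical
   strands. *)
case: (eqVneq (j - i) 0) => [/eqP|_]; rewrite /= ?mul1r.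
  rewrite subr_eq0 => /eqP ->.
  by case: o {dD tb}; case: x1; case: x2; eval_pull q_neq0; qfield q_neq0.
by case: o {dD tb}; case: x1; case: x2; eval_pull q_neq0; qfield q_neq0.
Qed.

Lemma Delta_crossing_right C o (i j wi wj wx wh : int) :
  let a := up i wi in
  let b := up j wj in
  let X := Xfrag a b (up (i + j) wx) b a in
  let H := Hright q a b (up (i - j) wh) b a in
  diagram (fill C (crossing o a b)) -> diagram (fill C X) ->
  diagram (fill C H.2) ->
  Delta q (fill C (crossing o a b))
  = (if o then q ^ (j - i - i * wj - j * wi)
     else q ^ (i - j + i * wj + j * wi)) / brace q (2 * j)
      * Delta q (fill C X)
    - (if o then q ^ (- i - j - i * wj - j * wi)
       else q ^ (i + j + i * wj + j * wi)) / brace q (2 * j)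
      * bracket q C H.
Proof.
move=> a b X H dD dX dH; have tb := fill_level dD.
have negE (y z t : F) : - (y / z * t) = (- y) / z * t by rewrite !mulNr.
rewrite -!bracket1 negE.
apply: (bracket_lin q_neq0 q_nonroot (f := (1, crossing o a b))
  (f1 := (1, X)) (f2 := H) tb dD dX dH) => [|phi [|x1 [|x2 x]] //= _].
  have := fill_piece_ok dD; rewrite piece_ok_cross => /andP[_ j0].
  by apply: brace_neq0; rewrite // mulf_eq0.
rewrite /frag_pull !mul1r /X /H /Hright /Xfrag /a /b {1}/mult /=.
rewrite /pull_layer /= ?take0 ?drop0 cross_up !big_bool /=.
case: (eqVneq (i - j) 0) => [/eqP|_]; rewrite /= ?mul1r.
  rewrite subr_eq0 => /eqP ->.
  by case: o {dD tb}; case: x1; case: x2; eval_pull q_neq0; qfield q_neq0.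
by case: o {dD tb}; case: x1; case: x2; eval_pull q_neq0; qfield q_neq0.
Qed.
End CrossingRelations.

(** * Disconnected diagrams *)

Section Disconnected.
Variables (F : fieldType) (q : F).
Hypothesis q_neq0 : q != 0.
Hypothesis q_nonroot : forall n : nat, (0 < n)%N -> q ^+ n != 1.

Local Notation act := (act q).
Local Notation pull := (pull q).
Local Notation delta := (delta F).

(** In a closed diagram the total charge of one part at a level is 0, so [anti] of the whole level
    vanishes; cutting right after the first strand tagged [true] leaves the single nonzero [level]
    of that strand. *)
Lemma anti_prefix (T : seq (bool * strand)) :
  true \in unzip1 T -> all (fun p => mult p.2 != 0) T ->
  exists A B, T = A ++ B /\ anti q A != 0.
Proof.
elim: T => [|[[] a] T IH] //= + /andP[a0 T0].
  move=> _; exists [:: (true, a)], T; split=> //=.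
  by rewrite mulr0 addr0 level_neq0.
rewrite inE /= => /IH /(_ T0) [A [B [-> nA]]].
by exists ((false, a) :: A), B.
Qed.

(* On strands tagged [true] the operator of [true] has a contracting homotopy,
   so the part of the diagram above [T] is in its image; below [M] the tags
   [false] make that operator vanish. *)
Lemma pull_untagged r M T D2 x :
  tag_typed (tag_all false r) M T -> tag_typed T D2 [::] ->
  true \in unzip1 T -> all (fun p => mult p.2 != 0) T -> size x = size r ->
  pull M (pull D2 delta) x = 0.
Proof.
move=> tM tD2 iT mT sx; have [A [B [eT nA]]] := anti_prefix iT mT.
set v := pull D2 delta.
have v0 y : size y = size T -> act true T v y = 0 by exact: act_closed.
have vE y : size y = size T ->
    v y = act true T (fun z => (anti q A)^-1 * act false A v z) y.
  move=> sy; rewrite actZ.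
  have := @act_anticomm F q false true A B v y.
  rewrite -eT => /(_ sy) /=.
  rewrite (@eq_act _ _ _ _ _ (fun=> 0)); last by move=> z sz; rewrite v0 // sz.
  by rewrite act0 add0r => ->; rewrite mulrA mulVf // mul1r.
have eqM : pull M v x
    = pull M (act true T (fun z => (anti q A)^-1 * act false A v z)) x.
  by apply: (eq_pull_tagged q tM); rewrite ?size_map.
rewrite eqM (pull_act q_neq0 true _ tM) ?size_map //.
exact: act_tag_false.
Qed.

Definition step_at (l : layer) (s t : seq bool) : Prop :=
  exists (x y : seq bool) (b : bool),
    [/\ size x = size (lft l), size y = size (rgt l),
        s = x ++ nseq (size (bottom (pc l))) b ++ y
      & t = x ++ nseq (size (top (pc l))) b ++ y].

Lemma zip_tag (b : bool) (s : seq strand) :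
  zip (nseq (size s) b) s = tag_all b s.
Proof. by elim: s => //= a s ->. Qed.

(** The names of the two parts serve as tags: a piece lies in one part, so its legs share a tag. *)
Lemma parted_tagged (c : nat -> seq bool) r D r' :
  typed r D r' -> size (c 0%N) = size r ->
  (forall n, (n < size D)%N ->
     step_at (nth (lone (Cup (up 1 0))) D n) (c n) (c n.+1)) ->
  tag_typed (zip (c 0%N) r) D (zip (c (size D)) r')
  /\ size (c (size D)) = size r'.
Proof.
elim: D c r => [|l D IHD] c r /=; first by move=> /eqP ->.
case/and3P=> /eqP -> okl tD sc st.
have [x [y [b [sx sy e0 e1]]]] := st 0%N isT.
have sc1 : size (c 1%N) = size (layer_top l).
  by rewrite e1 /layer_top !size_cat size_nseq sx sy.
have [tg ->] := IHD (fun n => c n.+1) _ tD sc1 (fun n => st n.+1).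
split=> //; exists (zip x (lft l)), (zip y (rgt l)), b.
rewrite !size_zip sx sy !minnn e0 /layer_bottom !zip_cat ?size_nseq //.
split=> //; first by rewrite zip_tag.
by move: tg; rewrite e1 /layer_top !zip_cat ?size_nseq // zip_tag.
Qed.

Lemma first_layer l D r : typed [::] (l :: D) r ->
  exists2 a, l = lone (Cup a) & mult a != 0.
Proof.
case: l => [[|? ?] p [|? ?]] /and3P[]; case: p => //= a _.
by rewrite piece_ok_cup; exists a.
Qed.

(** The base point lies on the first minimum, and the symmetry is applied only to the part not
    containing it, so that it does not see the base point. *)
Lemma Delta_disconnected D : diagram D -> disconnected D -> Delta q D = 0.
Proof.
move=> dD [c [c0 st [n nD nT] [n' nD' nF]]].
case: D dD st nD nD' => [|l D] dD st nD nD'.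
  by move: nD nT; rewrite leqn0 => /eqP ->; rewrite c0.
have [a el a0] := first_layer dD; subst l.
have [x [y [b [/= sx sy e0 e1]]]] := st 0%N isT.
have {sx sy e0 e1} c1 : c 1%N = [:: b; b].
  by rewrite e1; case: x sx {e0 e1}; case: y sy.
pose r := [:: a; dual a].
have tD : typed r D [::] by case/and3P: dD.
have t1 : typed [::] [:: lone (Cup a)] r.
  by rewrite /= /layer_bottom /layer_top piece_ok_cup a0 /= eqxx.
have val : Delta q (lone (Cup a) :: D) = base_value q [:: lone (Cup a)] a D.
  by apply: Delta_is_value => //; exists [:: lone (Cup a)], a, [:: dual a], D.
(* A level meeting the other part; it is not level 0, which is empty, and its index drops by one
   with the removal of the first layer. *)
have [m [mD mb]] : exists m, (m <= size D)%N /\ ~~ b \in c m.+1.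
  case: b {c1} => /=; [exists n'.-1 | exists n.-1].
    by move: nD' nF; case: (n') => [|k]; rewrite ?c0.
  by move: nD nT; case: (n) => [|k]; rewrite ?c0.
(* The part of the first minimum is tagged [false], the other one [true]. *)
pose c' k := [seq b (+) e | e <- c k.+1].
have st' k : (k < size D)%N ->
    step_at (nth (lone (Cup (up 1 0))) D k) (c' k) (c' k.+1).
  move=> kD; have [u [w [e [su sw eu ew]]]] := st k.+1 kD.
  exists (map (addb b) u), (map (addb b) w), (b (+) e).
  by rewrite !size_map /c' eu ew !map_cat !map_nseq.
have := tD; rewrite -{1}(cat_take_drop m D) => /typed_cat[r' tM tD2].
have sM : size (take m D) = m by rewrite size_takel.
have [tgM sc'] : tag_typed (zip (c' 0%N) r) (take m D) (zip (c' m) r')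
    /\ size (c' m) = size r'.
  rewrite -{2 3}sM; apply: parted_tagged => //; first by rewrite /c' c1.
  rewrite sM => k km; rewrite nth_take //.
  by apply: st'; apply: leq_trans km mD.
have [tg2 _] :
    tag_typed (zip (c' m) r') (drop m D) (zip (c' (size (drop m D) + m)) [::])
    /\ size (c' (size (drop m D) + m)%N) = size (@nil strand).
  apply: (parted_tagged (c := fun k => c' (k + m)%N)) => // k.
  rewrite size_drop => km; rewrite nth_drop addnC; apply: st'.
  by rewrite addnC -ltn_subRL.
rewrite val /base_value -{1}(cat_take_drop m D) pull_cat.
rewrite (eq_pull q t1 (psi := fun x => 0 * delta x)) //.
  by rewrite pullZ mul0r mulr0.
move=> z sz; rewrite mul0r /base0; case: ifP => // _.
have sr' : size (c' m) = size r' by [].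
have mr' := typed_mult tM (typed_mult t1 isT).
apply: (pull_untagged (r := r) (T := zip (c' m) r') _ _ _ _ sz).
- by move: tgM; rewrite {1}/c' c1 /= !addbb.
- have zn (u : seq bool) : zip u (@nil strand) = [::] by case: u.
  by move: tg2; rewrite zn.
- rewrite /unzip1 -/(unzip1 _) unzip1_zip ?sr' //.
  by apply/mapP; exists (~~ b) => //; case: (b).
have : all (fun a => mult a != 0) (unzip2 (zip (c' m) r')).
  by rewrite unzip2_zip ?sr'.
by rewrite all_map.
Qed.
End Disconnected.

Theorem theorem2p5 (F : fieldType) (q : F) (q_neq0 : q != 0)
    (q_nonroot : forall n : nat, (0 < n)%N -> q ^+ n != 1) :
  (* (i) *)
  (forall (D : word) (a : strand),
     diagram (circle a) -> isotopic D (circle a) ->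
     Delta q D = (brace q (2 * mult a))^-1)
  /\
  (* (ii) *)
  (forall D : word, diagram D -> disconnected D -> Delta q D = 0)
  /\
  (* (iii) *)
  (forall (C : context) (a : strand),
     diagram (fill C (half_twist true a)) ->
     Delta q (fill C (half_twist true a))
     = q ^ (- (mult a * wt a)) * Delta q (fill C [::]))
  /\
  (forall (C : context) (a : strand),
     diagram (fill C (half_twist false a)) ->
     Delta q (fill C (half_twist false a))
     = q ^ (mult a * wt a) * Delta q (fill C [::]))
  /\
  (* (iv) *)
  (forall (C : context) (i wi : int) (x y : strand),
     let D1 := bubble q (up i wi) x y in
     diagram (fill C D1.2) -> diagram (fill C [::]) ->
     bracket q C D1 = brace q (2 * i) * Delta q (fill C [::]))
  /\
  (* (v) *)
  (forall (C : context) (i j wi wj wab wda wbc wcd wrp : int),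
     let DL := square (up j wj) (dn i wi)
                 (up (i + j) wab) (dn i wda) (up j wbc) (up (i + j) wcd) in
     let D1 := vertical_bar q (up j wj) (dn i wi) (dn (i - j) wrp) in
     diagram (fill C DL) -> diagram (fill C D1.2) -> diagram (fill C [::]) ->
     Delta q (fill C DL)
     = brace q (2 * i + 2 * j) * bracket q C D1
       + brace q (2 * j) ^+ 2 * Delta q (fill C [::]))
  /\
  (* (vi) *)
  (forall (C : context) (i j k wi wj wk w wij wjk : int),
     let s := up (i + j + k) w in
     let DL := split_left s (up (i + j) wij) (up i wi) (up j wj) (up k wk) in
     let DR := split_right s (up (j + k) wjk) (up i wi) (up j wj) (up k wk) in
     diagram (fill C DL) -> diagram (fill C DR) ->
     Delta q (fill C DL)
     = brace q (2 * i + 2 * j) / brace q (2 * j + 2 * k)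
       * Delta q (fill C DR))
  /\
  (forall (C : context) (i j k wi wj wk w wij wjk : int),
     let s := up (i + j + k) w in
     let DL := merge_left (up i wi) (up j wj) (up k wk) (up (i + j) wij) s in
     let DR := merge_right (up i wi) (up j wj) (up k wk) (up (j + k) wjk) s in
     diagram (fill C DL) -> diagram (fill C DR) ->
     Delta q (fill C DL) = Delta q (fill C DR))
  /\
  (* (vii) *)
  (forall (C : context)
      (i j k l wbl wbr wk wml wmr wl wtl wtr wx wh : int),
     let bl := up i wbl in
     let br := up j wbr in
     let tl := up (i + k - l) wtl in
     let tr := up (j + l - k) wtr in
     let DL := ladder q bl br (up k wk) (up (i + k) wml) (up (j - k) wmr)
                 (up l wl) tl tr in
     let X := Xfrag bl br (up (i + j) wx) tl tr in
     let H := Hleft q bl br (up (k - l) wh) tl tr in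
     diagram (fill C DL.2) -> diagram (fill C X) -> diagram (fill C H.2) ->
     bracket q C DL
     = brace q (2 * j) * brace q (2 * l) / brace q (2 * j + 2 * l - 2 * k)
       * Delta q (fill C X)
       + brace q (2 * i + 2 * k - 2 * l) * brace q (2 * j - 2 * k)
         / brace q (2 * j + 2 * l - 2 * k)
         * bracket q C H)
  /\
  (* (viii) *)
  (forall (C : context) (i j wi wj wx whl whr : int),
     let a := up i wi in
     let b := up j wj in
     let Dplus := crossing true a b in
     let Dminus := crossing false a b in
     let X := Xfrag a b (up (i + j) wx) b a in
     let HL := Hleft q a b (up (j - i) whl) b a in
     let HR := Hright q a b (up (i - j) whr) b a in
     diagram (fill C Dplus) -> diagram (fill C Dminus) ->
     diagram (fill C X) -> diagram (fill C HL.2) -> diagram (fill C HR.2) ->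
     [/\ Delta q (fill C Dplus)
         = q ^ (i - j - i * wj - j * wi) / brace q (2 * i)
           * Delta q (fill C X)
           - q ^ (- i - j - i * wj - j * wi) / brace q (2 * i)
             * bracket q C HL,
         Delta q (fill C Dplus)
         = q ^ (j - i - i * wj - j * wi) / brace q (2 * j)
           * Delta q (fill C X)
           - q ^ (- i - j - i * wj - j * wi) / brace q (2 * j)
             * bracket q C HR,
         Delta q (fill C Dminus)
         = q ^ (j - i + i * wj + j * wi) / brace q (2 * i)
           * Delta q (fill C X)
           - q ^ (i + j + i * wj + j * wi) / brace q (2 * i)
             * bracket q C HL
       & Delta q (fill C Dminus)
         = q ^ (i - j + i * wj + j * wi) / brace q (2 * j)
           * Delta q (fill C X)
           - q ^ (i + j + i * wj + j * wi) / brace q (2 * j)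
             * bracket q C HR]).
Proof.
split; first by move=> D a; apply: Delta_circle.
split; first by move=> D; apply: Delta_disconnected.
split; first by move=> C a; apply: (Delta_half_twist _ _ (e := true)).
split; first by move=> C a; apply: (Delta_half_twist _ _ (e := false)).
split; first by move=> C i wi x y; apply: Delta_bubble.
split; first by move=> C i j wi wj wab wda wbc wcd wrp; apply: Delta_square.
split; first by move=> C i j k wi wj wk w wij wjk; apply: Delta_split_assoc.
split; first by move=> C i j k wi wj wk w wij wjk; apply: Delta_merge_assoc.
split.
  move=> C i j k l wbl wbr wk wml wmr wl wtl wtr wx wh.
  exact: Delta_ladder.
move=> C i j wi wj wx whl whr a b Dp Dm X HL HR dp dm dX dl dr; split.
- exact: (Delta_crossing_left q_neq0 q_nonroot dp dX dl).
- exact: (Delta_crossing_right q_neq0 q_nonroot dp dX dr).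
- exact: (Delta_crossing_left q_neq0 q_nonroot dm dX dl).
- exact: (Delta_crossing_right q_neq0 q_nonroot dm dX dr).
Qed.
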